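(* Every very strong suborbifold cover is a strong suborbifold cover; that is, if $\mathcal A$ is a countable orbifold atlas on a second countable Hausdorff space $X$, $Y\subset X$ is a subset, and $\{\widetilde V_j\}_{j\in J}$ is a very strong suborbifold cover on $Y$ with respect to $\mathcal A$, then $\{\widetilde V_j\}_{j\in J}$ is strong. Consequently also every very strong suborbifold of an orbifold is a strong suborbifold.
   Context: Manifolds are smooth, second countable and Hausdorff (except that the arrow manifold of a Lie groupoid need not be); submanifolds are embedded; group actions are smooth. **Orbifolds.** Let $X$ be a second countable Hausdorff space. An $n$-dimensional orbifold chart on $X$ is $(U,\widetilde U/\Gamma,\pi)$ with $U\subset X$ open, $\widetilde U$ a connected $n$-manifold, $\Gamma$ a finite group acting smoothly and effectively on $\widetilde U$, and $\pi\colon\widetilde U\to U$ continuous, $\Gamma$-invariant, inducing a homeomorphism $\widetilde U/\Gamma\to U$. For charts with $U_1\subset U_2$, an injection from $\pi_1$ to $\pi_2$ is a smooth embedding $\lambda\colon\widetilde U_1\to\widetilde U_2$ with $\pi_2\circ\lambda=\pi_1$. Two charts are compatible if every $x\in U_1\cap U_2$ lies in some $W\subset U_1\cap U_2$ for a chart $(W,\widetilde W/K,\sigma)$ admitting injections into both. An atlas is a collection of pairwise compatible charts covering $X$; an orbifold $(X,\mathcal A)$ is such an $X$ with a maximal atlas $\mathcal A$. **Suborbifold covers.** If a finite group $\Gamma$ acts on a manifold $M$ and $\Delta\subset\Gamma$ is a subgroup, a $\Delta$-invariant submanifold $N\subset M$ is a $\Delta$-submanifold if for all $\gamma\in\Gamma$,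 $p\in N$ with $\gamma p\in N$ there is $\delta\in\Delta$ with $\delta p=\gamma p$. Given an atlas $\mathcal A=\{(U_i,\widetilde U_i/\Gamma_i,\pi_i)\}_{i\in I}$ on $X$ and $Y\subset X$, a $k$-dimensional closed suborbifold cover on $Y$ with respect to $\mathcal A$ is a subset $J\subset I$ and a family $\{\widetilde V_j\}_{j\in J}$ of connected $k$-manifolds such that for every $j$ the set $\widetilde V_j$ is closed in $\widetilde U_j$ and there is a subgroup $\Delta_j\subset\Gamma_j$ for which $\widetilde V_j$ is a $\Delta_j$-submanifold of $\widetilde U_j$ with $\pi_j(\widetilde V_j)$ open in $Y$, and $\bigcup_j\pi_j(\widetilde V_j)=Y$. The induced orbifold atlas on $Y$ is $\mathcal B=\{(\pi_j(\widetilde V_j),\widetilde V_j/(\Delta_j/K_j),{\pi_j}_{|\widetilde V_j})\}_{j\in J}$, where $K_j\subset\Delta_j$ is the kernel of the action on $\widetilde V_j$ (a different choice of $\Delta_j$ gives an equivalent effective action on $\widetilde V_j$). **Groupoid of an atlas.** A Lie groupoid morphism $\Phi=(\Phi_0,\Phi_1)\colon H\to G$ is a pair of smooth maps on objects and arrows respecting all structure maps; it is a Lie groupoid embedding if $\Phi_0,\Phi_1$ are smooth embeddings of manifolds. $|G|$ is the orbit space of $G$ and $|\Phi|\colon|H|\to|G|$, $Hp\mapsto G\Phi_0(p)$, the induced map. For a countable orbifold atlas $\mathcal A=\{(U_i,\widetilde U_i/\Gamma_i,\pi_i)\}_{i\in I}$ on $X$, the Lie groupoid $\mathcal G(\mathcal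 A)$ has objects $\mathcal G(\mathcal A)_0=\coprod_{i}\widetilde U_i$. With $\pi=\coprod_i\pi_i$ and $P(\mathcal A)$ the set of diffeomorphisms $f$ between open subsets of $\mathcal G(\mathcal A)_0$ with $\pi\circ f=\pi_{|\mathrm{dom} f}$, the arrows are the germs $[f]_p$ with $f\in P(\mathcal A)$, $p\in\mathrm{dom} f$; the smooth structure is determined by requiring each $\mathrm{dom} f\ni p\mapsto[f]_p\in\{[f]_q: q\in\mathrm{dom} f\}$ to be a diffeomorphism; $s([f]_p)=p$, $t([f]_p)=f(p)$, and multiplication, unit, inverse are composition, identity germ, inverse germ. $\varepsilon_{\mathcal A}\colon|\mathcal G(\mathcal A)|\to X$ is the homeomorphism induced by $\pi$. **Strong.** A closed suborbifold cover on $Y$ with respect to a countable atlas $\mathcal A$ on $X$, with induced atlas $\mathcal B$ on $Y$, is strong if there is a Lie groupoid embedding $\Phi\colon\mathcal G(\mathcal B)\to\mathcal G(\mathcal A)$ such that $\varepsilon_{\mathcal A}\circ|\Phi|$ equals $\varepsilon_{\mathcal B}$ followed by the inclusion $Y\hookrightarrow X$. **Very strong.** A closed $k$-dimensional suborbifold cover $\{\widetilde V_j\}_{j\in J}$ on $Y$ with respect to a countable atlas $\mathcal A$ is very strong if: (i) if $j\in J$ and $\gamma\in\Gamma_j$ fixes (pointwise) some (nonempty) open subset of $\widetilde V_j$, then $\gamma=e$; (ii) for any $j_1,j_2\in J$ and $x\in\pi_{j_1}(\widetilde V_{j_1})\cap\pi_{j_2}(\widetilde V_{j_2})$ there are an orbifold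 chart $(W,\widetilde W/K,\sigma)$ on $X$, a subgroup $\Lambda\subset K$ and a $k$-dimensional $\Lambda$-submanifold $\widetilde Z$ of $\widetilde W$ such that $\sigma(\widetilde Z)$ is an open neighbourhood of $x$ in $Y$, and injections $\lambda_m\colon\widetilde W\to\widetilde U_{j_m}$ ($m=1,2$) with $\lambda_m(\widetilde Z)\subset\widetilde V_{j_m}$. A subset $Y$ of an orbifold $(X,\mathcal A)$ is a strong (resp. very strong) suborbifold if there is a strong (resp. very strong) suborbifold cover on $Y$ with respect to some countable atlas contained in $\mathcal A$. *)

(* Defs.v *)
From HB Require Import structures.
From mathcomp Require Import all_boot all_order all_algebra all_fingroup.
From mathcomp Require Import all_classical all_reals all_analysis.

Set Implicit Arguments.
Unset Strict Implicit.
Unset Printing Implicit Defensive.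

Import Order.TTheory GRing.Theory Num.Theory.
Import numFieldTopology.Exports numFieldNormedType.Exports.

Local Open Scope classical_set_scope.
Local Open Scope ring_scope.

(* Structures (spaces with charts, orbifold charts, groupoids) are records of
   raw data; the axioms of manifolds and of orbifold charts are the predicates
   [manifold] and [orbifold_chart].  In this way coproducts, submanifolds and
   spaces of germs, which are manifolds (the latter possibly not Hausdorff or
   second countable), are plain definitions. *)

Section SmoothSpaces.
Context {R : realType}.

(* g is C^infinity on a neighbourhood of v: all iterated directional
   derivatives of g are (Frechet) differentiable there. *)
Definition smooth_near m n (g : 'rV[R]_m -> 'rV[R]_n) (v : 'rV[R]_m) : Prop :=
  \forall w \near v, forall s : seq 'rV[R]_m,
    differentiable (foldr (fun u (h : 'rV[R]_m -> 'rV[R]_n) => 'D_u h) g s) w.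

(* The values of [cmap] outside [cdom] are irrelevant. *)
Record chart (T : Type) (n : nat) := Chart {
  cdom : set T;
  cmap :> T -> 'rV[R]_n }.

Record smooth_space (n : nat) := SmoothSpace {
  stype :> topologicalType;
  charts : set (chart stype n) }.
Arguments charts {n} s _.

(* Near x, f is represented in the charts c and d by the smooth map g. *)
Definition local_rep m n (M : smooth_space m) (N : smooth_space n) (f : M -> N)
    (c : chart M m) (d : chart N n) (x : M) (g : 'rV[R]_m -> 'rV[R]_n) : Prop :=
  [/\ cdom c x, smooth_near g (c x)
    & \forall y \near x, cdom d (f y) /\ d (f y) = g (c y)].

Section Manifold.
Context {n : nat} (M : smooth_space n).

Definition homeo_chart (c : chart M n) : Prop :=
  [/\ open (cdom c), {in cdom c &, injective c}, {in cdom c, continuous c}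
    & forall O, open O -> O `<=` cdom c -> open (c @` O)].

Definition smooth_transition (c d : chart M n) : Prop :=
  forall x, cdom c x -> cdom d x -> exists g, local_rep (@id M) c d x g.

Definition maximal_charts : set (chart M n) := [set c | homeo_chart c /\
  forall d, charts M d -> smooth_transition c d /\ smooth_transition d c].

Definition manifold : Prop :=
  [/\ hausdorff_space M, @second_countable M,
      forall x : M, exists2 c, charts M c & cdom c x
    & charts M `<=` maximal_charts].

(* c maps cdom c `&` V onto c (cdom c) `&` (R^k x 0) *)
Definition slice_chart (k : nat) (V : set M) (c : chart M n) : Prop :=
  maximal_charts c /\ forall y, cdom c y ->
    (V y <-> forall i : 'I_n, (k <= i)%N -> c y 0 i = 0).

Definition submanifold (k : nat) (V : set M) : Prop :=
  (k <= n)%N /\ forall p, V p -> exists2 c, slice_chart k V c & cdom c p.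

(* A submanifold as a manifold in its own right: the charts are the
   restrictions of slice charts, followed by R^k x 0 -> R^k. *)
Definition sub_charts (k : nat) (V : set M) : set (chart (set_type V) k) :=
  [set e | exists (kn : (k <= n)%N) (c : chart M n),
    [/\ slice_chart k V c, cdom e = set_val @^-1` cdom c
      & forall y, cdom e y ->
          e y = \row_i c (set_val y) 0 (widen_ord kn i)]].

Definition sub_space (k : nat) (V : set M) : smooth_space k :=
  SmoothSpace (stype := set_type V) (@sub_charts k V).

End Manifold.

Definition coprod_charts n (I : choiceType) (M : I -> smooth_space n) :
    set (chart {i & M i} n) :=
  [set e | exists (i : I) (c : chart (M i) n),
    [/\ charts (M i) c, cdom e = existT (fun i => M i : Type) i @` cdom c
      & forall y, cdom c y -> e (existT (fun i => M i : Type) i y) = c y]].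

Definition coprod n (I : choiceType) (M : I -> smooth_space n) :
    smooth_space n :=
  SmoothSpace (stype := {i & M i}) (@coprod_charts n I M).

Section Maps.
Context {m n : nat} {M : smooth_space m} {N : smooth_space n}.

Definition smooth_at (f : M -> N) (x : M) : Prop :=
  exists c d g, [/\ charts M c, charts N d & local_rep f c d x g].

Definition smooth_map (f : M -> N) : Prop := forall x, smooth_at f x.

Definition immersion_at (f : M -> N) (x : M) : Prop :=
  exists c d g, [/\ charts M c, charts N d, local_rep f c d x g
                  & injective ('d g (c x))].

Definition smooth_embedding (f : M -> N) : Prop :=
  [/\ smooth_map f, forall x, immersion_at f x, injective f
    & forall A : set M, open A <-> exists2 B : set N, open B & A = f @^-1` B].

End Maps.

Definition local_diffeo m n (M : smooth_space m) (N : smooth_space n)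
    (D : set M) (f : M -> N) : Prop :=
  [/\ open D, open (f @` D), forall x, D x -> smooth_at f x
    & exists g : N -> M,
        (forall x, D x -> g (f x) = x) /\ forall y, (f @` D) y -> smooth_at g y].

End SmoothSpaces.
Arguments smooth_space : clear implicits.
Arguments chart : clear implicits.
Arguments charts {R n} s _.

(* Multiplication, unit and inverse are given by their graphs: [gmul b a c]
   means that the product b a (defined when gsrc b = gtgt a) is c. *)
Record groupoid (R : realType) (n m : nat) := Groupoid {
  gobj : smooth_space R n;
  garr : smooth_space R m;
  gsrc : garr -> gobj;
  gtgt : garr -> gobj;
  gmul : garr -> garr -> garr -> Prop;
  gunit : gobj -> garr -> Prop;
  ginv : garr -> garr -> Prop }.

Section Groupoids.
Context {R : realType}.

Definition groupoid_morphism n m n' m'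
    (H : groupoid R n m) (G : groupoid R n' m')
    (F0 : gobj H -> gobj G) (F1 : garr H -> garr G) : Prop :=
  [/\ smooth_map F0 /\ smooth_map F1,
      forall a, gsrc (F1 a) = F0 (gsrc a) /\ gtgt (F1 a) = F0 (gtgt a),
      forall b a c, gmul b a c -> gmul (F1 b) (F1 a) (F1 c),
      forall p u, gunit p u -> gunit (F0 p) (F1 u)
    & forall a b, ginv a b -> ginv (F1 a) (F1 b)].

Definition groupoid_embedding n m n' m'
    (H : groupoid R n m) (G : groupoid R n' m')
    (F0 : gobj H -> gobj G) (F1 : garr H -> garr G) : Prop :=
  [/\ groupoid_morphism F0 F1, smooth_embedding F0 & smooth_embedding F1].

Definition gorbit n m (G : groupoid R n m) (p : gobj G) : set (gobj G) :=
  [set q | exists a, gsrc a = p /\ gtgt a = q].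

Definition gorbit_space n m (G : groupoid R n m) : set (set (gobj G)) :=
  range (@gorbit n m G).

(* For a morphism with object map F0, the orbit of p is sent to the orbit of
   F0 p, which is here the union of the orbits of the F0 q, q in the orbit
   of p. *)
Definition gorbit_map n m n' m' (H : groupoid R n m) (G : groupoid R n' m')
    (F0 : gobj H -> gobj G) (O : set (gobj H)) : set (gobj G) :=
  \bigcup_(p in O) gorbit (F0 p).

End Groupoids.
Arguments gorbit_space {R n m} G _.

Section GermGroupoid.
Context {R : realType} {n : nat} (M : smooth_space R n) {X : Type}.
Variable pi : M -> X.

Definition over_diffeo (D : set M) (f : M -> M) : Prop :=
  local_diffeo D f /\ forall x, D x -> pi (f x) = pi x.

(* The germ of f at p is (p, f p, {g | g = f near p}): maps are total, and
   their values away from p do not matter. *)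
Definition germ_at (f : M -> M) (p : M) : M * M * set (M -> M) :=
  (p, f p, [set g | \forall q \near p, g q = f q]).

Definition germ_set : set (M * M * set (M -> M)) :=
  [set a | exists D f p, [/\ over_diffeo D f, D p & a = germ_at f p]].

Definition germ_arrow : Type := set_type germ_set.

HB.instance Definition _ := gen_eqMixin germ_arrow.
HB.instance Definition _ := gen_choiceMixin germ_arrow.

(* The final topology for the maps dom f -> germ_arrow, p |-> [f]_p. *)
Definition germ_open (A : set germ_arrow) : Prop :=
  forall D f, over_diffeo D f ->
    open [set p | D p /\ exists2 a, A a & val a = germ_at f p].

Lemma germ_openT : germ_open setT.
Proof.
move=> D f Df; rewrite (_ : [set p | _] = D); first by case: Df => -[].
apply/seteqP; split=> [p []//|p Dp]; split=> //.
have fpP : germ_at f p \in germ_set by apply/mem_set; exists D, f, p.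
by exists (exist (fun a => a \in germ_set) _ fpP).
Qed.

Lemma germ_openI : setI_closed germ_open.
Proof.
move=> A B oA oB D f Df.
rewrite (_ : [set p | _] =
    [set p | D p /\ exists2 a, A a & val a = germ_at f p] `&`
    [set p | D p /\ exists2 a, B a & val a = germ_at f p]).
  by apply: openI; [exact: oA|exact: oB].
apply/seteqP; split=> p.
  by case=> Dp [a [Aa Ba] ap]; split; split=> //; exists a.
move=> [[Dp [a Aa ap]] [_ [b Bb bp]]]; split=> //; exists a => //; split=> //.
by rewrite (_ : a = b)//; apply: val_inj; rewrite ap bp.
Qed.

Lemma germ_open_bigU (J : Type) (F : J -> set germ_arrow) :
  (forall j, germ_open (F j)) -> germ_open (\bigcup_j F j).
Proof.
move=> oF D f Df; rewrite (_ : [set p | _] =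
    \bigcup_j [set p | D p /\ exists2 a, F j a & val a = germ_at f p]).
  by apply: bigcup_open => j _; exact: oF.
apply/seteqP; split=> p.
  by case=> Dp [a [j _ Fja] ap]; exists j => //; split=> //; exists a.
by case=> j _ [Dp [a Fja ap]]; split=> //; exists a => //; exists j.
Qed.

HB.instance Definition _ := @isOpenTopological.Build germ_arrow
  germ_open germ_openT germ_openI germ_open_bigU.

Definition germ_src (a : germ_arrow) : M := (val a).1.1.
Definition germ_tgt (a : germ_arrow) : M := (val a).1.2.

(* On the sheet {[f]_p | p in dom f}, the charts are those of M composed with
   [f]_p |-> p. *)
Definition germ_charts : set (chart R germ_arrow n) :=
  [set e | exists D f c, [/\ over_diffeo D f, charts M c,
      cdom e = [set a | exists p, [/\ D p, cdom c p & val a = germ_at f p]]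
    & forall a, cdom e a -> e a = c (germ_src a)]].

Definition germ_groupoid : groupoid R n n := {|
  gobj := M;
  garr := SmoothSpace (stype := germ_arrow) germ_charts;
  gsrc := germ_src;
  gtgt := germ_tgt;
  gmul := fun b a c => exists f g p,
    [/\ val a = germ_at g p, val b = germ_at f (g p)
      & val c = germ_at (f \o g) p];
  gunit := fun p a => val a = germ_at id p;
  ginv := fun a b => exists f g p,
    [/\ val a = germ_at f p, val b = germ_at g (f p),
        germ_at (g \o f) p = germ_at id p
      & germ_at (f \o g) (f p) = germ_at id (f p)] |}.

End GermGroupoid.

(* (U, U~/Gamma, pi) is encoded as oset = U, otop = U~, ogrp = Gamma,
   oproj = pi. *)
Record ochart (R : realType) (X : topologicalType) (n : nat) := OChart {
  oset : set X;
  otop : smooth_space R n;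
  ogrp : finGroupType;
  oact : ogrp -> otop -> otop;
  oproj : otop -> X }.
Arguments oact {R X n} o _ _.
Arguments oproj {R X n} o _.

Section Orbifolds.
Context {R : realType}.

Section OrbifoldCharts.
Context {X : topologicalType} {n : nat}.
Implicit Types c d w : ochart R X n.

Definition smooth_effective_action c : Prop :=
  [/\ forall x, oact c 1%g x = x,
      forall (a b : ogrp c) x, oact c (a * b)%g x = oact c a (oact c b x),
      forall a : ogrp c, smooth_map (oact c a)
    & forall a : ogrp c, (forall x, oact c a x = x) -> a = 1%g].

(* The last two conditions express that the continuous map oproj induces a
   bijection otop / ogrp -> oset, respectively that the inverse of that
   bijection is continuous for the quotient topology. *)
Definition orbifold_chart c : Prop :=
  [/\ open (oset c),
      manifold (otop c) /\ connected [set: otop c],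
      smooth_effective_action c,
      continuous (oproj c)
    & [/\ range (oproj c) = oset c,
        forall x y : otop c, oproj c x = oproj c y <-> exists a, oact c a x = y
      & forall O, O `<=` oset c -> open (oproj c @^-1` O) -> open O]].

Definition chart_injection c d (l : otop c -> otop d) : Prop :=
  [/\ oset c `<=` oset d, smooth_embedding l
    & forall x, oproj d (l x) = oproj c x].

Definition compatible_charts c d : Prop :=
  forall x, oset c x -> oset d x -> exists w,
    [/\ orbifold_chart w, oset w x, oset w `<=` oset c `&` oset d,
        exists l, @chart_injection w c l & exists l, @chart_injection w d l].

(* [set] cannot be used for collections of charts, for universe reasons. *)
Definition orbifold_atlas (S : ochart R X n -> Prop) : Prop :=
  [/\ forall c, S c -> orbifold_chart c,
      forall c d, S c -> S d -> compatible_charts c d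
    & forall x : X, exists2 c, S c & oset c x].

Definition orbifold (S : ochart R X n -> Prop) : Prop :=
  [/\ hausdorff_space X, @second_countable X, orbifold_atlas S
    & forall c, orbifold_chart c ->
        (forall d, S d -> compatible_charts c d) -> S c].

Definition group_submanifold c (D : {group ogrp c}) (k : nat)
    (N : set (otop c)) : Prop :=
  [/\ submanifold k N,
      forall a p, a \in D -> N p -> N (oact c a p)
    & forall (a : ogrp c) p, N p -> N (oact c a p) ->
        exists2 b, b \in D & oact c b p = oact c a p].

End OrbifoldCharts.

Definition atlas_objects X n (I : choiceType) (A : I -> ochart R X n) :
  smooth_space R n := coprod (fun i => otop (A i)).

Definition atlas_map X n (I : choiceType) (A : I -> ochart R X n)
  (p : atlas_objects A) : X := oproj (A (projT1 p)) (projT2 p).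

Definition atlas_groupoid X n (I : choiceType) (A : I -> ochart R X n) :
  groupoid R n n := germ_groupoid (@atlas_map X n I A).

(* The map from the orbit space of [atlas_groupoid A] to X, with a point x
   represented as the singleton [set x]. *)
Definition atlas_eps X n (I : choiceType) (A : I -> ochart R X n)
  (O : set (gobj (atlas_groupoid A))) : set X := @atlas_map X n I A @` O.
Arguments atlas_eps {X n I} A O _.

(* [sgrp j] is the group called D_j below.  These groups are part of the data,
   but [very_strong] does not mention them, and in [strong] they only enter
   the groups of the induced atlas, on which its groupoid does not depend. *)
Record suborbifold_cover (X : topologicalType) (n : nat) (I : choiceType)
    (A : I -> ochart R X n) (Y : set X) (k : nat) := SuborbifoldCover {
  sidx : set I;
  ssub : forall j : sidx, set (otop (A (set_val j)));
  sgrp : forall j : sidx, {group ogrp (A (set_val j))};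
  ssub_connected : forall j, connected (@ssub j);
  ssub_closed : forall j, closed (@ssub j);
  ssub_submanifold : forall j, group_submanifold (sgrp j) k (@ssub j);
  ssub_open : forall j,
    exists2 O : set X, open O & oproj (A (set_val j)) @` @ssub j = O `&` Y;
  ssub_cover : \bigcup_(j : sidx) (oproj (A (set_val j)) @` @ssub j) = Y }.
Arguments sidx {X n I A Y k} s.
Arguments ssub {X n I A Y k} s j _.
Arguments sgrp {X n I A Y k} s j.

Section Covers.
Context {X : topologicalType} {n : nat} {I : choiceType}.
Context {A : I -> ochart R X n} {Y : set X} {k : nat}.
Variable C : suborbifold_cover A Y k.

Lemma oproj_ssub (j : sidx C) (x : set_type (ssub C j)) :
  oproj (A (set_val j)) (set_val x) \in Y.
Proof.
apply/mem_set; have /seteqP[sub _] := ssub_cover C; apply: sub.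
exists j => //.
by exists (set_val x) => //; exact: set_valP.
Qed.

Definition skernel (j : sidx C) : {set ogrp (A (set_val j))} :=
  [set a in sgrp C j |
    `[< forall p, ssub C j p -> oact _ a p = p >]]%SET.

(* The chart (pi_j(V_j), V_j / (D_j / K_j), pi_j|V_j) on the space Y.  A coset
   of the kernel K_j acts by any of its elements; the default value of
   [insubd] is not used, because V_j is D_j-invariant. *)
Definition induced_chart (j : sidx C) : ochart R (set_type Y) k := {|
  oset := set_val @^-1` (oproj (A (set_val j)) @` ssub C j);
  otop := sub_space k (ssub C j);
  ogrp := subg_of (sgrp C j / skernel j)%G;
  oact := fun q x => insubd x (oact _ (repr (sgval q)) (set_val x));
  oproj := fun x => exist _ (oproj (A (set_val j)) (set_val x)) (oproj_ssub x) |}.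

Definition strong : Prop :=
  exists (F0 : gobj (atlas_groupoid induced_chart) -> gobj (atlas_groupoid A))
         (F1 : garr (atlas_groupoid induced_chart) -> garr (atlas_groupoid A)),
    groupoid_embedding F0 F1 /\
    forall O, gorbit_space (atlas_groupoid induced_chart) O ->
      atlas_eps A (gorbit_map F0 O) = set_val @` atlas_eps induced_chart O.

Definition very_strong : Prop :=
  (forall (j : sidx C) (a : ogrp (A (set_val j)))
      (O : set (otop (A (set_val j)))),
    open O -> O `&` ssub C j !=set0 ->
    (forall p, (O `&` ssub C j) p -> oact _ a p = p) -> a = 1%g) /\
  (forall (j1 j2 : sidx C) (x : X),
    (oproj (A (set_val j1)) @` ssub C j1) x ->
    (oproj (A (set_val j2)) @` ssub C j2) x ->
    exists (w : ochart R X n) (L : {group ogrp w}) (Z : set (otop w)),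
      [/\ orbifold_chart w,
          group_submanifold L k Z,
          (oproj w @` Z) x /\
            (exists2 O : set X, open O & oproj w @` Z = O `&` Y),
          exists l : otop w -> otop (A (set_val j1)),
            chart_injection l /\ l @` Z `<=` ssub C j1
        & exists l : otop w -> otop (A (set_val j2)),
            chart_injection l /\ l @` Z `<=` ssub C j2]).

End Covers.

Definition members X n (I : choiceType) (A : I -> ochart R X n) :
  ochart R X n -> Prop := fun c => exists i, c = A i.

Definition countable_subatlas X n (S : ochart R X n -> Prop) (I : countType)
    (A : I -> ochart R X n) : Prop :=
  orbifold_atlas (members A) /\ forall i, S (A i).

Definition strong_suborbifold X n (S : ochart R X n -> Prop) (Y : set X) :
    Prop :=
  exists (I : countType) (A : I -> ochart R X n) (k : nat)
         (C : suborbifold_cover A Y k), countable_subatlas S A /\ strong C.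

Definition very_strong_suborbifold X n (S : ochart R X n -> Prop) (Y : set X) :
    Prop :=
  exists (I : countType) (A : I -> ochart R X n) (k : nat)
         (C : suborbifold_cover A Y k), countable_subatlas S A /\ very_strong C.

End Orbifolds.

(* Main.v *)
(** Let [f] be a diffeomorphism between open sets of the induced atlas, over [Y].
    Near a point of its domain, condition (ii) provides a chart [w] with two
    injections; composed with group elements they become local diffeomorphisms
    [mu1] and [mu2] that map a slice of [w] onto open pieces of the two members
    of the cover involved.  Then [f] and [mu2 mu1^-1] differ on the first piece
    by a map which sends each point into its orbit under a finite group.  Such a
    map agrees near each point with a single group element: the sets of points
    at which it agrees with a given element form a finite closed cover, so the
    closures of their interiors still cover; and if two such closures meet at
    [y], the quotient of the two elements is tangent to the identity at [y],
    hence is the identity near [y] by averaging, hence is trivial by condition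
    (i).  This extends [f] to a diffeomorphism over [X].  The germ of the
    extension is unique: two extensions differ by a group element which fixes
    an open piece of a member of the cover, trivial by (i).  So germs of [f] map
    to germs of its extension; this is the required embedding, whose object map
    is the inclusion. *)
Require Import Defs.
From mathcomp Require Import all_boot all_order all_algebra all_fingroup.
From mathcomp Require Import all_classical all_reals all_analysis.
From HB Require Import structures.
From mathcomp Require Import ring lra.

Set Implicit Arguments.
Unset Strict Implicit.
Unset Printing Implicit Defensive.

Import Order.TTheory GRing.Theory Num.Theory.
Import numFieldTopology.Exports numFieldNormedType.Exports.

Local Open Scope classical_set_scope.
Local Open Scope ring_scope.

(** * Functions of class C^r *)

(** The obstacle is that a group element is found only pointwise: the map |x| on the line preserves
    the orbits of x -> -x, but agrees with different elements on the two sides of 0. Smoothness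
    excludes this. If two elements each agree with the map on open sets accumulating at a point,
    both have there the derivative of the map, so first derivatives already suffice. The argument is
    used twice, with different groups. A germ is extended after applying it on the k-dimensional
    member of the cover with its own subgroup, to which the definition of a group submanifold
    reduces the orbit relation. Uniqueness applies it in the ambient chart with the whole group,
    since two maps that agree on the member are a priori unrelated off it. Condition (i) yields the
    faithfulness needed in both cases, because it concerns all elements of the group of the chart
    and open pieces of the member. Local diffeomorphisms are treated as pairs of total maps inverse
    to each other near a point. The inverse function theorem supplies them for injections of charts,
    for their restrictions to slices, and for the averages of a group action. *)

Section Cr.
Context {R : realType}.

(* [U] is fixed because [smooth_near] asks for one neighbourhood on which the
   derivatives of all orders exist. *)
Fixpoint Cr m (r : nat) (U : set 'rV[R]_m) (f : 'rV[R]_m -> R) : Prop :=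
  (forall w, U w -> differentiable f w) /\
  if r is r'.+1 then forall u, Cr r' U (fun w => 'D_u f w) else True.

Section Scalar.
Context {m : nat} (U : set 'rV[R]_m).
Hypothesis oU : open U.
Implicit Types f g : 'rV[R]_m -> R.

Lemma Cr_diff r f w : Cr r U f -> U w -> differentiable f w.
Proof. by case: r => [|r] [+ _] Uw; exact. Qed.

Lemma near_open (P : 'rV[R]_m -> Prop) w : U w -> (forall x, U x -> P x) ->
  \forall x \near w, P x.
Proof. by move=> Uw UP; apply: filterS UP _; exact: open_nbhs_nbhs. Qed.

(** The differential is a chosen linear map, so locality rests on the uniqueness of the first-order
    expansion. *)
Lemma differentiable_near_eq (W : normedModType R) (f g : 'rV[R]_m -> W) w :
  (\forall x \near w, f x = g x) -> differentiable f w -> differentiable g w.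
Proof.
move=> fg /diff_locallyP[cf df].
have fgw : f w = g w by exact: nbhs_singleton fg.
suff E : g \o shift w = cst (g w) + 'd f w +o_ 0 id.
  by apply/diff_locallyP; rewrite (diff_unique cf E).
apply/eqaddoP => e e0; have /eqaddoP/(_ e e0) := df.
have : \forall h \near (0 : 'rV[R]_m), f (h + w) = g (h + w).
  by move: fg; rewrite (near_shift 0) subr0.
apply: filterS2 => h fgh.
by rewrite /= -!fgw /= -[(_ - _) h]/(_ - _) /= fgh.
Qed.

Lemma Cr_eq r f g : (forall w, U w -> f w = g w) -> Cr r U f -> Cr r U g.
Proof.
elim: r f g => [|r IH] f g fg /= [df Df]; split=> //.
- by move=> w Uw; apply: differentiable_near_eq (df w Uw); exact: near_open.
- by move=> w Uw; apply: differentiable_near_eq (df w Uw); exact: near_open.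
move=> u; apply: IH (Df u) => w Uw.
by apply: near_eq_derive; exact: near_open.
Qed.

Lemma CrW r f : Cr r.+1 U f -> Cr r U f.
Proof.
elim: r f => [|r IH] f [df Df]; split=> //.
by move=> u; exact/IH/Df.
Qed.

Lemma Cr_cst r a : Cr r U (fun=> a).
Proof.
elim: r a => [|r IH] a; split=> //; try by move=> w _; exact: differentiable_cst.
move=> u; apply: Cr_eq (IH 0) => w _.
by rewrite (derive_cst a).
Qed.

Lemma Cr_coord r i : Cr r U (fun x => x 0 i).
Proof.
case: r => [|r]; split=> //; try by move=> w _; exact: differentiable_coord.
move=> u; apply: Cr_eq (Cr_cst r (u 0 i)) => w _.
have -> : 'D_u (fun x : 'rV[R]_m => x 0 i) w = ('D_u id w) 0 i.
  by rewrite derive_mx ?mxE//; exact: derivable_id.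
by rewrite derive_id.
Qed.

Lemma Cr_D r f g : Cr r U f -> Cr r U g -> Cr r U (fun x => f x + g x).
Proof.
elim: r f g => [|r IH] f g [df Df] [dg Dg]; split=> //.
- by move=> w Uw; apply: differentiableD; [exact: df|exact: dg].
- by move=> w Uw; apply: differentiableD; [exact: df|exact: dg].
move=> u; apply: Cr_eq (IH _ _ (Df u) (Dg u)) => w Uw.
by rewrite (@deriveD _ _ _ f g)//; apply: diff_derivable; [exact: df|exact: dg].
Qed.

Lemma Cr_M r f g : Cr r U f -> Cr r U g -> Cr r U (fun x => f x * g x).
Proof.
elim: r f g => [|r IH] f g Cf Cg; have [df Df] := Cf; have [dg Dg] := Cg; split=> //.
- by move=> w Uw; apply: differentiableM; [exact: df|exact: dg].
- by move=> w Uw; apply: differentiableM; [exact: df|exact: dg].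
move=> u.
apply: Cr_eq (Cr_D (IH _ _ (CrW Cf) (Dg u)) (IH _ _ (CrW Cg) (Df u))) => w Uw.
by rewrite (@deriveM _ _ f g)//; apply: diff_derivable; [exact: df|exact: dg].
Qed.

Lemma Cr_V r f : (forall w, U w -> f w != 0) -> Cr r U f ->
  Cr r U (fun x => (f x)^-1).
Proof.
move=> f0; elim: r f f0 => [|r IH] f f0 Cf; have [df Df] := Cf; split=> //.
- by move=> w Uw; apply: differentiableV; [exact: df|exact: f0].
- by move=> w Uw; apply: differentiableV; [exact: df|exact: f0].
move=> u; have Ci := IH _ f0 (CrW Cf).
apply: Cr_eq (Cr_M (Cr_M (Cr_cst r (-1)) (Cr_M Ci Ci)) (Df u)) => w Uw.
rewrite deriveV; [|exact: f0|by apply: diff_derivable; exact: df].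
by rewrite -mulr_algl /= mulN1r mulNr expr2 invfM /GRing.scale/= mulr1 mulNr.
Qed.

Lemma Cr_sum r (I : Type) (s : seq I) (P : pred I) (F : I -> 'rV[R]_m -> R) :
  (forall i, P i -> Cr r U (F i)) -> Cr r U (fun x => \sum_(i <- s | P i) F i x).
Proof.
move=> CF; elim: s => [|i s IH].
  by apply: Cr_eq (Cr_cst r 0) => w _; rewrite big_nil.
apply: (@Cr_eq _ (fun x => (if P i then F i x else 0) + \sum_(i <- s | P i) F i x)).
  by move=> w _; rewrite big_cons; case: ifP; rewrite ?add0r.
by apply: Cr_D => //; case: (boolP (P i)) => Pi; [exact: CF|exact: Cr_cst].
Qed.

Lemma Cr_prod r (I : Type) (s : seq I) (P : pred I) (F : I -> 'rV[R]_m -> R) :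
  (forall i, P i -> Cr r U (F i)) -> Cr r U (fun x => \prod_(i <- s | P i) F i x).
Proof.
move=> CF; elim: s => [|i s IH].
  by apply: Cr_eq (Cr_cst r 1) => w _; rewrite big_nil.
apply: (@Cr_eq _ (fun x => (if P i then F i x else 1) * \prod_(i <- s | P i) F i x)).
  by move=> w _; rewrite big_cons; case: ifP; rewrite ?mul1r.
by apply: Cr_M => //; case: (boolP (P i)) => Pi; [exact: CF|exact: Cr_cst].
Qed.

(** Together with [Cr_adj] and [Cr_V] this serves Cramer's rule: the entries of an inverse Jacobian
    are as regular as those of the Jacobian. *)
Lemma Cr_det r n (F : 'rV[R]_m -> 'M[R]_n) : (forall i j, Cr r U (fun x => F x i j)) ->
  Cr r U (fun x => \det (F x)).
Proof.
move=> CF; apply: Cr_sum => s _; apply: Cr_M; first exact: Cr_cst.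
exact: Cr_prod.
Qed.

Lemma Cr_adj r n (F : 'rV[R]_m -> 'M[R]_n) i j : (forall i j, Cr r U (fun x => F x i j)) ->
  Cr r U (fun x => \adj (F x) i j).
Proof.
move=> CF; apply: (@Cr_eq _ (fun x => (-1) ^+ (j + i) * \det (row' j (col' i (F x))))).
  by move=> w _; rewrite mxE.
apply: Cr_M; first exact: Cr_cst.
by apply: Cr_det => k l; apply: Cr_eq (CF (lift j k) (lift i l)) => w _; rewrite !mxE.
Qed.

End Scalar.

Lemma CrS m r (U W : set 'rV[R]_m) f : W `<=` U -> Cr r U f -> Cr r W f.
Proof.
move=> WU; elim: r f => [|r IH] f [df Df]; split=> //; try by move=> w /WU /df.
by move=> u; exact/IH/Df.
Qed.

Lemma differentiable_coords (V : normedModType R) n (g : V -> 'rV[R]_n) w :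
  (forall i, differentiable (fun x => g x 0 i) w) -> differentiable g w.
Proof.
move=> dg.
have -> : g = \sum_(i < n) (fun x => g x 0 i *: delta_mx 0 i).
  by apply/funext => x; rewrite fct_sumE; exact: row_sum_delta.
by apply: differentiable_sum => i; exact: differentiableZl.
Qed.

Lemma derive_coord m n (g : 'rV[R]_m -> 'rV[R]_n) u w i : differentiable g w ->
  'D_u (fun x => g x 0 i) w = ('D_u g w) 0 i.
Proof. by move=> dg; rewrite derive_mx ?mxE//; exact: diff_derivable. Qed.

Lemma Cr_comp m n r (U : set 'rV[R]_m) (W : set 'rV[R]_n) f (g : 'rV[R]_m -> 'rV[R]_n) :
  open U -> (forall x, U x -> W (g x)) -> Cr r W f ->
  (forall i, Cr r U (fun x => g x 0 i)) -> Cr r U (fun x => f (g x)).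
Proof.
move=> oU UW; elim: r f => [|r IH] f Cf Cg.
  split=> // w Uw; apply: (@differentiable_comp _ _ _ _ g f).
    by apply: differentiable_coords => i; exact: Cr_diff (Cg i) Uw.
  exact: Cr_diff Cf (UW _ Uw).
have dg w : U w -> differentiable g w.
  by move=> Uw; apply: differentiable_coords => i; exact: Cr_diff (Cg i) Uw.
have df w : U w -> differentiable f (g w).
  by move=> Uw; exact: Cr_diff Cf (UW _ Uw).
split=> [w Uw|u].
  by apply: (@differentiable_comp _ _ _ _ g f); [exact: dg|exact: df].
(* Chain rule in coordinates: the partial derivatives of [f] are of class r, so the induction
   hypothesis applies to their composites with [g]. *)
apply: (@Cr_eq _ _ oU _ (fun x => \sum_(i < n)
    'D_u (fun x => g x 0 i) x * 'D_(delta_mx 0 i) f (g x))).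
  move=> w Uw.
  rewrite (@deriveE _ _ _ (f \o g)); last exact: differentiable_comp (dg _ Uw) (df _ Uw).
  rewrite diff_comp; [|exact: dg|exact: df].
  rewrite /= [in RHS](row_sum_delta ('d g w u)) linear_sum /=; apply: eq_bigr => i _.
  rewrite linearZ derive_coord; last exact: dg.
  by rewrite deriveE; [rewrite deriveE//; exact: df|exact: dg].
apply: (Cr_sum oU) => i _; apply: (Cr_M oU).
  by have [_] := Cg i; exact.
apply: (IH (fun y => 'D_(delta_mx 0 i) f y)) => [|j]; last exact/CrW/Cg.
by have [_] := Cf; exact.
Qed.

End Cr.

(** * Smooth maps between coordinate spaces *)

Section SmoothNear.
Context {R : realType}.

Definition smooth_on m n (U : set 'rV[R]_m) (g : 'rV[R]_m -> 'rV[R]_n) :=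
  forall r i, Cr r U (fun x => g x 0 i).

Lemma smooth_on_diff m n (U : set 'rV[R]_m) (g : 'rV[R]_m -> 'rV[R]_n) w :
  smooth_on U g -> U w -> differentiable g w.
Proof.
by move=> sg Uw; apply: differentiable_coords => i; exact: Cr_diff (sg 0%N i) Uw.
Qed.

Lemma smooth_on_derive m n (U : set 'rV[R]_m) (g : 'rV[R]_m -> 'rV[R]_n) u :
  open U -> smooth_on U g -> smooth_on U (fun w => 'D_u g w).
Proof.
move=> oU sg r i; have [_ /(_ u)] := sg r.+1 i.
by apply: Cr_eq => // w Uw; rewrite derive_coord//; exact: smooth_on_diff Uw.
Qed.

Lemma differentiable_coordW m n (g : 'rV[R]_m -> 'rV[R]_n) w i :
  differentiable g w -> differentiable (fun x => g x 0 i) w.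
Proof.
by move=> dg; exact: (differentiable_comp dg (differentiable_coord (g w) 0 i)).
Qed.

(** Passes from iterated directional derivatives to the coordinatewise classes [Cr], where products
    and composites are handled by induction on the order. *)
Lemma smooth_nearP m n (g : 'rV[R]_m -> 'rV[R]_n) v :
  smooth_near g v <-> exists U, [/\ open U, U v & smooth_on U g].
Proof.
split=> [|[U [oU Uv sg]]]; last first.
  apply: (near_open oU Uv) => w Uw s.
  suff : smooth_on U (foldr (fun u (h : 'rV[R]_m -> 'rV[R]_n) => 'D_u h) g s).
    by move=> /smooth_on_diff; exact.
  by elim: s => //= u s; exact: smooth_on_derive.
rewrite /smooth_near -nbhs_nearE nbhsE => -[U [oU Uv] UP].
pose D s := foldr (fun u (h : 'rV[R]_m -> 'rV[R]_n) => 'D_u h) g s.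
exists U; split=> // r i.
suff : forall s, Cr r U (fun x => D s x 0 i) by move=> /(_ [::]).
elim: r => [|r IH] s.
  split=> // w /UP/(_ s) dg.
  exact: differentiable_coordW.
split=> [w /UP/(_ s) dg|u].
  exact: differentiable_coordW.
apply: (Cr_eq oU _ (IH (u :: s))) => w /UP/(_ s) dg.
by rewrite derive_coord.
Qed.

Lemma smooth_near_comp m n p (f : 'rV[R]_n -> 'rV[R]_p) (g : 'rV[R]_m -> 'rV[R]_n) v :
  smooth_near f (g v) -> smooth_near g v -> smooth_near (f \o g) v.
Proof.
move=> /smooth_nearP[W [oW Wgv sf]] /smooth_nearP[U [oU Uv sg]].
apply/smooth_nearP; exists (U `&` g @^-1` W); split=> //.
  rewrite openE => w [Uw Wgw]; apply: filterI; first exact: open_nbhs_nbhs.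
  by apply: differentiable_continuous (smooth_on_diff sg Uw) _ _; exact: open_nbhs_nbhs.
move=> r i; apply: (@Cr_comp _ _ _ _ _ W (fun x => f x 0 i)) => //.
- rewrite openE => w [Uw Wgw]; apply: filterI; first exact: open_nbhs_nbhs.
  by apply: differentiable_continuous (smooth_on_diff sg Uw) _ _; exact: open_nbhs_nbhs.
- by move=> x [].
- by move=> j; apply: CrS (sg r j) => x [].
Qed.

Lemma smooth_near_eq m n (f g : 'rV[R]_m -> 'rV[R]_n) v :
  (\forall w \near v, f w = g w) -> smooth_near f v -> smooth_near g v.
Proof.
rewrite -nbhs_nearE nbhsE => -[W [oW Wv] fg] /smooth_nearP[U [oU Uv sf]].
have oUW : open (U `&` W) by exact: openI.
apply/smooth_nearP; exists (U `&` W); split=> // r i.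
apply: (@Cr_eq _ _ _ oUW _ (fun x => f x 0 i)) => [w [_ /fg ->]//|].
by apply: CrS (sf r i) => x [].
Qed.

Lemma smooth_near_near m n (g : 'rV[R]_m -> 'rV[R]_n) v :
  smooth_near g v -> \forall w \near v, smooth_near g w.
Proof.
move=> /smooth_nearP[U [oU Uv sg]].
by apply: (near_open oU Uv) => w Uw; apply/smooth_nearP; exists U.
Qed.

Lemma smooth_near_diff m n (g : 'rV[R]_m -> 'rV[R]_n) v :
  smooth_near g v -> differentiable g v.
Proof. by move=> /smooth_nearP[U [oU Uv sg]]; exact: smooth_on_diff Uv. Qed.

Lemma smooth_near_cont m n (g : 'rV[R]_m -> 'rV[R]_n) v :
  smooth_near g v -> {for v, continuous g}.
Proof. by move=> /smooth_near_diff/differentiable_continuous. Qed.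

Lemma smooth_near_derive_cont m n (g : 'rV[R]_m -> 'rV[R]_n) u v :
  smooth_near g v -> {for v, continuous (fun w => 'D_u g w)}.
Proof.
move=> /smooth_nearP[U [oU Uv sg]]; apply: smooth_near_cont.
by apply/smooth_nearP; exists U; split=> //; exact: smooth_on_derive.
Qed.

Lemma smooth_near_mulmx m n (A : 'M[R]_(m, n)) v :
  smooth_near (fun x : 'rV[R]_m => x *m A) v.
Proof.
have oT : open [set: 'rV[R]_m] by exact: openT.
apply/smooth_nearP; exists setT; split=> // r i.
apply: (@Cr_eq _ _ _ oT _ (fun x => \sum_j x 0 j * A j i)) => [w _|].
  by rewrite mxE.
by apply: (Cr_sum oT) => j _; apply: (Cr_M oT); [exact: Cr_coord|exact: Cr_cst].
Qed.

Lemma smooth_near_id m v : smooth_near (fun x : 'rV[R]_m => x) v.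
Proof.
apply: smooth_near_eq (smooth_near_mulmx 1%:M v).
by near=> w; rewrite mulmx1.
Unshelve. all: by end_near. Qed.

Lemma smooth_near_add m n (f g : 'rV[R]_m -> 'rV[R]_n) v :
  smooth_near f v -> smooth_near g v -> smooth_near (fun x => f x + g x) v.
Proof.
move=> /smooth_nearP[U [oU Uv sf]] /smooth_nearP[W [oW Wv sg]].
have oUW : open (U `&` W) by exact: openI.
apply/smooth_nearP; exists (U `&` W); split=> // r i.
apply: (@Cr_eq _ _ _ oUW _ (fun x => f x 0 i + g x 0 i)) => [w _|]; first by rewrite mxE.
by apply: (Cr_D oUW); [apply: CrS (sf r i)|apply: CrS (sg r i)] => x [].
Qed.

Lemma smooth_near_sum m n k (F : 'I_k -> 'rV[R]_m -> 'rV[R]_n) v :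
  (forall i, smooth_near (F i) v) -> smooth_near (fun x => \sum_i F i x) v.
Proof.
move=> sF; elim: (index_enum _) => [|i s IH].
  apply: smooth_near_eq (smooth_near_mulmx 0 v).
  by near=> w; rewrite big_nil mulmx0.
by apply: smooth_near_eq (smooth_near_add (sF i) IH); near=> w; rewrite big_cons.
Unshelve. all: by end_near. Qed.

Lemma diff_mulmx m n (A : 'M[R]_(m, n)) v u :
  'd (fun x : 'rV[R]_m => x *m A) v u = u *m A.
Proof.
have @f : {linear 'rV[R]_m -> 'rV[R]_n} := mulmxr A.
rewrite (_ : (fun _ => _) = f)// diff_lin// => w.
exact: smooth_near_cont (smooth_near_mulmx A w).
Qed.

End SmoothNear.

(** * The inverse function theorem *)

(** Joins completeness with the normed structure, as Banach's fixed point theorem requires. *)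
HB.instance Definition _ (R : realType) m n := Complete.on 'M[R]_(m, n).

Section InverseFunction.
Context {R : realType}.

Lemma mx_norm_leP m n (x : 'M[R]_(m, n)) e : 0 <= e ->
  `|x| <= e <-> forall i j, `|x i j| <= e.
Proof.
move=> e0; rewrite /Num.Def.normr/= mx_normrE; split=> [xe i j|xe].
  by apply: le_trans xe; exact: (le_bigmax _ (fun ij => `|x ij.1 ij.2|) (i, j)).
by apply: bigmax_le => // -[i j] _; exact: xe.
Qed.

Lemma segment_norm m (a b v : 'rV[R]_m) r t : `|a - v| <= r -> `|b - v| <= r ->
  0 <= t <= 1 -> `|b + t *: (a - b) - v| <= r.
Proof.
move=> ar br /andP[t0 t1].
have -> : b + t *: (a - b) - v = (1 - t) *: (b - v) + t *: (a - v).
  by apply/rowP => i; rewrite !mxE; ring.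
apply: le_trans (ler_normD _ _) _; rewrite !normrZ ger0_norm ?subr_ge0// ger0_norm//.
have -> : r = (1 - t) * r + t * r by ring.
by apply: lerD; apply: ler_wpM2l; rewrite ?subr_ge0.
Qed.

Lemma near_closed_ball m (v : 'rV[R]_m) (P : 'rV[R]_m -> Prop) :
  (\forall w \near v, P w) ->
  exists2 r, 0 < r & forall w, `|w - v| <= r -> P w.
Proof.
move=> /nbhs_ballP[r /= r0 rP]; exists (r / 2); first by rewrite divr_gt0.
move=> w wr; apply: rP; rewrite -ball_normE /= distrC (le_lt_trans wr)//.
by rewrite ltr_pdivrMr// ltr_pMr// ltr1n.
Qed.

(** The partial derivatives vanish at [v], hence are small nearby by continuity; the mean value
    theorem on segments turns this into a Lipschitz bound. *)
Lemma near_critical_lipschitz m n (F : 'rV[R]_m -> 'rV[R]_n) v e : 0 < e -> smooth_near F v ->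
  (forall u, 'D_u F v = 0) ->
  exists r, [/\ 0 < r,
    forall a u, `|a - v| <= r -> `|'D_u F a| <= e * `|u| &
    forall a b, `|a - v| <= r -> `|b - v| <= r -> `|F a - F b| <= e * `|a - b|].
Proof.
move=> e0 sF DF0.
have m0 : 0 < m.+1%:R :> R by rewrite ltr0n.
(* A directional derivative is a sum of [m] terms, each at most [|u|] times this constant; [m.+1]
   keeps the denominator nonzero when [m] is 0. *)
have em0 : 0 < e / m.+1%:R by rewrite divr_gt0.
have small : \forall w \near v, smooth_near F w /\
    forall j, `|'D_(delta_mx 0 j) F w| <= e / m.+1%:R.
  apply: filterI; first exact: smooth_near_near.
  apply: (@filter_forall _ _ (fun j w => `|'D_(delta_mx 0 j) F w| <= e / m.+1%:R) (nbhs v)) => j.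
  have := @smooth_near_derive_cont _ _ _ _ (delta_mx 0 j) _ sF.
  move=> /cvgr_dist_le/(_ _ em0); apply: filterS => w /=.
  by rewrite DF0 sub0r normrN.
have [r r0 rP] := near_closed_ball small.
have DF a u : `|a - v| <= r -> `|'D_u F a| <= e * `|u|.
  move=> /rP[sFa Fa]; have dF := smooth_near_diff sFa.
  rewrite deriveE// {1}(row_sum_delta u) linear_sum.
  apply: le_trans (ler_norm_sum _ _ _) _.
  apply: (@le_trans _ _ (\sum_(i < m) `|u| * (e / m.+1%:R))).
    apply: ler_sum => i _; rewrite linearZ normrZ; apply: ler_pM => //.
      by apply/(mx_norm_leP u (normr_ge0 _)).1.
    by rewrite -deriveE//.
  rewrite sumr_const card_ord -[leLHS]mulr_natr -mulrA mulrC.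
  apply: ler_wpM2r => //.
  by rewrite mulrAC ler_pdivrMr// ler_pM2l// ler_nat.
exists r; split=> // a b ar br.
apply/mx_norm_leP => [|i j]; first by rewrite mulr_ge0// ltW.
rewrite ord1 {i} !mxE.
(* The mean value theorem is scalar, so it is applied to each coordinate [j] along the segment; the
   norm is the maximum over the coordinates. *)
pose c (t : R) := b + t *: (a - b).
have cr t : 0 <= t <= 1 -> `|c t - v| <= r by exact: segment_norm.
pose phi (t : R) : R := F (c t) 0 j.
have dphi (t : R) : 0 <= t <= 1 -> is_derive t 1 phi (('D_(a - b) F (c t)) 0 j).
  move=> /cr/rP[/smooth_near_diff dF _].
  have E : (fun h : R => h^-1 *: ((phi \o shift t) (h *: (1 : R^o)) - phi t)) =
      (fun h : R => h^-1 *: (((fun x => F x 0 j) \o shift (c t)) (h *: (a - b)) - F (c t) 0 j)).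
    apply/funext => h; congr (_ *: (F _ 0 j - _)).
    by apply/rowP => i; rewrite !mxE /GRing.scale/=; ring.
  have dFj := diff_derivable (differentiable_coordW j dF).
  apply: DeriveDef; first by rewrite /derivable E; exact: dFj.
  by rewrite /derive E -(derive_coord (a - b) j dF).
have [t t01 E] : exists2 t, t \in `[0, 1]%R & phi 1 - phi 0 = ('D_(a - b) F (c t)) 0 j * (1 - 0).
  apply: MVT_segment => //.
    by move=> t; rewrite in_itv/= => /andP[t0 t1]; apply: dphi; rewrite !ltW.
  apply: derivable_within_continuous => t; rewrite in_itv/= => t01.
  by have [] := dphi _ t01.
have -> : F a 0 j - F b 0 j = ('D_(a - b) F (c t)) 0 j.
  rewrite subr0 mulr1 in E; rewrite -E /phi /c scale1r scale0r addr0.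
  by rewrite (addrC b) subrK.
rewrite in_itv/= in t01.
have := DF _ (a - b) (cr _ t01).
by move=> /(mx_norm_leP _ _).1; apply; rewrite mulr_ge0// ltW.
Qed.

End InverseFunction.

Section InverseFunctionTheorem.
Context {R : realType}.

Lemma closed_ball_fixpoint m (v : 'rV[R]_m) r (T : 'rV[R]_m -> 'rV[R]_m) : 0 < r ->
  (forall a, `|a - v| <= r -> `|T a - v| <= r) ->
  (forall a b, `|a - v| <= r -> `|b - v| <= r -> `|T a - T b| <= 2^-1 * `|a - b|) ->
  exists2 a, `|a - v| <= r & T a = a.
Proof.
move=> r0 TB TL; pose B := closed_ball_ Num.Def.normr v r.
have BE a : B a <-> `|a - v| <= r by rewrite /B /closed_ball_/= distrC.
have homT : {homo T : x / B x >-> B x} by move=> x /BE/TB/BE.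
have ctr : is_contraction (mkfun homT).
  exists (2^-1)%:nng; split => /=; first by rewrite invf_lt1 ?ltr1n.
  by move=> [a b] /= [/BE Ba /BE Bb]; exact: TL.
have [||a /BE Ba aE] := banach_fixed_point ctr.
- exact: closed_closed_ball_.
- by exists v; apply/BE; rewrite subrr normr0 ltW.
by exists a.
Qed.

Section Normalized.
Context {m : nat} (g : 'rV[R]_m -> 'rV[R]_m) (v : 'rV[R]_m).
Hypothesis sg : smooth_near g v.
Hypothesis Dg : forall u, 'D_u g v = u.

Let F x := x - g x.

(** As [g] is tangent to the identity at [v], the map [F] is a contraction of ratio 1/2 near [v],
    and solving [g a = y] means finding a fixed point of [F a + y]. *)
Lemma inverse_function_normalized : exists gi, [/\ smooth_near gi (g v),
  \forall w \near v, gi (g w) = w & \forall z \near g v, g (gi z) = z].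
Proof.
have sF : smooth_near F v.
  apply: smooth_near_eq (smooth_near_add (smooth_near_id v)
    (smooth_near_comp (smooth_near_mulmx (- 1%:M) _) sg)).
  by near=> w; rewrite /F /= mulmxN mulmx1.
have DF w u : differentiable g w -> 'D_u F w = u - 'D_u g w.
  move=> dg; rewrite (@deriveB _ _ _ id g)//; last exact: diff_derivable.
  by rewrite derive_id.
have /smooth_nearP[U [oU Uv sgU]] := sg.
have [r1 r10 r1U] := near_closed_ball (open_nbhs_nbhs (conj oU Uv)).
have [||r2 [r20 DFr2 Fr2]] := @near_critical_lipschitz _ _ _ _ _ 2^-1 _ sF.
- by rewrite invr_gt0.
- by move=> u; rewrite DF ?Dg ?subrr//; exact: smooth_near_diff.
pose r := Num.min r1 r2.
have r0 : 0 < r by rewrite lt_min r10.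
have rU w : `|w - v| <= r -> U w.
  by rewrite le_min => /andP[/r1U].
have dgr w : `|w - v| <= r -> differentiable g w.
  by move=> /rU; exact: smooth_on_diff.
have Fr a b : `|a - v| <= r -> `|b - v| <= r -> `|F a - F b| <= 2^-1 * `|a - b|.
  by rewrite !le_min => /andP[_ ar] /andP[_ br]; exact: Fr2.
(* This makes the Jacobian of [g] injective on the whole ball, not only at [v]. *)
have Dlow a u : `|a - v| <= r -> `|u| <= 2 * `|'D_u g a|.
  move=> ar; have := ar; rewrite le_min => /andP[_ /(DFr2 _ u)].
  rewrite DF; last exact: dgr.
  move=> D; have := ler_normD (u - 'D_u g a) ('D_u g a); rewrite subrK.
  by move: D; lra.
have low a b : `|a - v| <= r -> `|b - v| <= r -> `|a - b| <= 2 * `|g a - g b|.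
  move=> ar br; have := Fr _ _ ar br.
  have := ler_normD (F a - F b) (g a - g b).
  have -> : F a - F b + (g a - g b) = a - b.
    by rewrite /F; apply/rowP => i; rewrite !mxE; ring.
  by lra.
(* Contraction keeps [F a] within r / 2 of [F v], which leaves r / 2 for the displacement of [y]. *)
have surj y : `|y - g v| <= r / 2 -> exists2 a, `|a - v| <= r & g a = y.
  move=> yr; have [||a ar aE] := @closed_ball_fixpoint _ v r (fun a => F a + y) r0.
  - move=> a ar; have -> : F a + y - v = (F a - F v) + (y - g v).
      by rewrite /F; apply/rowP => i; rewrite !mxE; ring.
    apply: le_trans (ler_normD _ _) _.
    have := Fr _ _ ar; move=> /(_ v); rewrite subrr normr0 => /(_ (ltW r0)).
    by move: ar yr; lra.
  - by move=> a b ar br; rewrite opprD addrACA subrr addr0; exact: Fr.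
  exists a => //; move: aE; rewrite /F => /rowP aE; apply/rowP => i.
  by have := aE i; rewrite !mxE; lra.
(* The default [v] is not taken on the ball of radius [r / 2], by [surj]. *)
pose gi y := xget v [set a | `|a - v| <= r /\ g a = y].
have giP y : `|y - g v| <= r / 2 -> `|gi y - v| <= r /\ g (gi y) = y.
  move=> /surj[a ar gay]; rewrite /gi.
  by case: xgetP => [b -> []//|/(_ a)]; case.
pose W := ball (g v) (r / 2).
have WE y : W y <-> `|y - g v| < r / 2 by rewrite /W -ball_normE /= distrC.
have oW : open W by exact: ball_open.
have Wgv : W (g v) by apply/WE; rewrite subrr normr0 divr_gt0.
have WP y : W y -> [/\ `|gi y - v| < r, `|gi y - v| <= r & g (gi y) = y].
  move=> /WE yr; have [giy gE] := giP _ (ltW yr); split=> //.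
  have := low _ v giy; rewrite subrr normr0 gE => /(_ (ltW r0)).
  by move: yr; lra.
have giL y z : W y -> W z -> `|gi y - gi z| <= 2 * `|y - z|.
  move=> /WP[_ yr yE] /WP[_ zr zE].
  by have := low _ _ yr zr; rewrite yE zE.
pose J a := lin1_mx ('d g a).
have JE a u : `|a - v| <= r -> 'D_u g a = u *m J a.
  by move=> ar; rewrite mul_rV_lin1 deriveE//; exact: dgr.
have Junit a : `|a - v| <= r -> J a \in unitmx.
  move=> ar; rewrite -row_free_unit -kermx_eq0; apply/eqP/row_matrixP => i.
  apply/eqP; rewrite row0 -normr_le0.
  apply: le_trans (Dlow _ (row i (kermx (J a))) ar) _.
  by rewrite JE// -row_mul mulmx_ker row0 normr0 mulr0.
have dgi y : W y -> differentiable gi y /\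
    forall u, 'D_u gi y = u *m invmx (J (gi y)).
  move=> Wy; have [_ yr gyE] := WP _ Wy; set a := gi y in yr gyE *.
  pose B : {linear 'rV[R]_m -> 'rV[R]_m} := mulmxr (invmx (J a)).
  have cB : continuous B by move=> w; exact: smooth_near_cont (smooth_near_mulmx _ w).
  suff E : gi \o shift y = cst (gi y) + B +o_ 0 id.
    have dB := diff_unique cB E.
    have dgi : differentiable gi y by apply/diff_locallyP; rewrite dB.
    by split=> // u; rewrite deriveE// dB.
  apply/eqaddoP => e e0.
  have [k k0 kB] := linear_lipschitz cB.
  (* [k] bounds the inverse Jacobian [B], and 2 is the Lipschitz constant of [gi], so an error
     [e / (2 * k)] for [g] becomes at most [e] for [gi]. *)
  have e'0 : 0 < e / (2 * k) by rewrite divr_gt0// mulr_gt0.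
  have /diff_locally/eqaddoP/(_ _ e'0) := dgr _ yr.
  move=> /nbhs_ballP[d /= d0 dP].
  have : \forall h \near (0 : 'rV[R]_m), W (h + y).
    have : \forall h \near y, W h by exact: open_nbhs_nbhs.
    by rewrite (near_shift 0) subr0.
  have : \forall h \near (0 : 'rV[R]_m), `|h| < d / 2.
    apply/nbhs_ballP; exists (d / 2) => /=; [by rewrite divr_gt0|].
    by move=> h; rewrite -ball_normE /= sub0r normrN.
  apply: filterS2 => h hd Wh; rewrite /= -[(_ - _) h]/(_ - _) /= -[(_ + _) h]/(_ + _) /= -/a.
  pose q := gi (h + y) - a.
  have qh : `|q| <= 2 * `|h| by have := giL _ _ Wh Wy; rewrite addrK.
  have /dP : ball 0 d q.
    by rewrite -ball_normE /= sub0r normrN; move: qh hd; lra.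
  rewrite /= -[(_ - _) q]/(_ - _) /= -[(_ + _) q]/(_ + _) /=.
  have [_ _ hE] := WP _ Wh.
  rewrite {1}/q subrK hE gyE => dq.
  have dqJ : 'd g a q = q *m J a by rewrite mul_rV_lin1.
  have -> : gi (h + y) - (a + h *m invmx (J a)) = - B (h + y - (y + 'd g a q)).
    rewrite dqJ /B /=.
    have -> : h + y - (y + q *m J a) = h - q *m J a by rewrite opprD addrA addrK.
    rewrite mulmxBl -mulmxA.
    by rewrite mulmxV ?Junit// mulmx1 opprB /q opprD addrA.
  rewrite normrN; apply: le_trans (kB _) _.
  apply: (@le_trans _ _ (k * (e / (2 * k) * (2 * `|h|)))).
    apply: ler_wpM2l; first exact: ltW.
    by apply: le_trans dq _; apply: ler_wpM2l => //; exact: ltW.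
  have -> // : k * (e / (2 * k) * (2 * `|h|)) = e * `|h|.
  by field; rewrite gt_eqF.
(* Bootstrapping: the derivative of [gi] at [y] is the inverse Jacobian at [gi y], which is of class
   s as soon as [gi] is. *)
have sgi : smooth_on W gi.
  move=> s; elim: s => [|s IH] i.
    by split=> // y /dgi[dy _]; exact: differentiable_coordW.
  split=> [y /dgi[dy _]|u]; first exact: differentiable_coordW.
  have CJ k l : Cr s W (fun y => J (gi y) k l).
    apply: (@Cr_comp _ _ _ _ _ U (fun x => J x k l)) => //.
      by move=> y /WP[_ /rU].
    have := smooth_on_derive 'e_k oU sgU s l.
    apply: Cr_eq => // x Ux.
    have dx : differentiable g x by exact: smooth_on_diff Ux.
    by rewrite deriveE// /J mxE.
  apply: (@Cr_eq _ _ _ oW _ (fun y => \sum_j u 0 j *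
      ((\det (J (gi y)))^-1 * \adj (J (gi y)) j i))).
    move=> y Wy; have [dy Dy] := dgi _ Wy; have [_ yr _] := WP _ Wy.
    rewrite derive_coord// Dy mxE; apply: eq_bigr => j _.
    by rewrite /invmx (Junit _ yr) !mxE.
  apply: (Cr_sum oW) => j _; apply: (Cr_M oW); first exact: Cr_cst.
  apply: (Cr_M oW); last exact: Cr_adj.
  apply: Cr_V => //; last exact: Cr_det.
  by move=> y /WP[_ yr _]; have := Junit _ yr; rewrite unitmxE unitfE.
exists gi; split.
- by apply/smooth_nearP; exists W.
- have : \forall w \near v, W (g w).
    by apply: smooth_near_cont sg _ _; exact: open_nbhs_nbhs.
  have : \forall w \near v, `|w - v| <= r.
    by apply/nbhs_ballP; exists r => //= w; rewrite -ball_normE /= distrC => /ltW.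
  apply: filterS2 => w wr Wgw; have [_ gr gE] := WP _ Wgw.
  apply/eqP; rewrite -subr_eq0 -normr_le0.
  by have := low _ _ gr wr; rewrite gE subrr normr0 mulr0.
- by apply: (near_open oW Wgv) => y /WP[].
Unshelve. all: by end_near. Qed.

End Normalized.

Lemma inverse_function m (g : 'rV[R]_m -> 'rV[R]_m) v : smooth_near g v ->
  injective ('d g v) -> exists gi, [/\ smooth_near gi (g v),
    \forall w \near v, gi (g w) = w & \forall z \near g v, g (gi z) = z].
Proof.
move=> sg ig; pose A := lin1_mx ('d g v).
have dA u : 'd g v u = u *m A by rewrite mul_rV_lin1.
have uA : A \in unitmx.
  rewrite -row_free_unit -kermx_eq0; apply/eqP/row_matrixP => i; rewrite row0.
  by apply: ig; rewrite linear0 dA -row_mul mulmx_ker row0.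
have sB v' := smooth_near_mulmx (invmx A) v'.
pose G w := g w *m invmx A.
have sG : smooth_near G v := smooth_near_comp (sB (g v)) sg.
have [u|Gi [sGi GiG GGi]] := inverse_function_normalized sG.
  rewrite deriveE; last exact: smooth_near_diff.
  have E : 'd G v = 'd (mulmx^~ (invmx A)) (g v) \o 'd g v :> ('rV[R]_m -> 'rV[R]_m).
    exact: (diff_comp (smooth_near_diff sg) (smooth_near_diff (sB (g v)))).
  by rewrite E /= diff_mulmx dA -mulmxA mulmxV// mulmx1.
exists (Gi \o mulmx^~ (invmx A)); split=> //.
  exact: (@smooth_near_comp _ _ _ _ Gi (mulmx^~ (invmx A)) (g v) sGi (sB (g v))).
have H : \forall y \near g v, G (Gi (y *m invmx A)) = y *m invmx A.
  exact: (smooth_near_cont (sB (g v)) GGi).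
near=> y; have /(congr1 (mulmx^~ A)) : G (Gi (y *m invmx A)) = y *m invmx A by near: y.
by rewrite /G /= -!mulmxA mulVmx// !mulmx1.
Unshelve. all: by end_near. Qed.
End InverseFunctionTheorem.

(** * Smooth maps between manifolds *)

Section Premanifold.
Context {R : realType}.

(** The part of [manifold] concerning charts, which passes to submanifolds and coproducts; the
    Hausdorff property is assumed separately where values of maps have to be separated. *)
Definition premanifold n (M : smooth_space R n) :=
  (forall x : M, exists2 c, charts M c & cdom c x) /\ (forall c, charts M c -> maximal_charts c).

Lemma manifold_premanifold n (M : smooth_space R n) : manifold M -> premanifold M.
Proof. by case. Qed.

Lemma maximal_homeo n (M : smooth_space R n) (c : chart R M n) : maximal_charts c -> homeo_chart c.
Proof. by case. Qed.

Lemma charts_maximal n (M : smooth_space R n) (c : chart R M n) :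
  premanifold M -> charts M c -> maximal_charts c.
Proof. by move=> [_]; exact. Qed.

Section Chart.
Context {n : nat} {M : smooth_space R n} (c : chart R M n).
Hypothesis hc : homeo_chart c.

Lemma chart_dom_near x : cdom c x -> \forall y \near x, cdom c y.
Proof. by case: hc => oc _ _ _ cx; exact: open_nbhs_nbhs. Qed.

Lemma chart_cont x : cdom c x -> {for x, continuous c}.
Proof. by case: hc => _ _ + _ cx; apply; apply/mem_set. Qed.

Lemma chart_inj x y : cdom c x -> cdom c y -> c x = c y -> x = y.
Proof. by case: hc => _ ci _ _ cx cy; apply: ci; apply/mem_set. Qed.

Lemma chart_open_near x (P : M -> Prop) : cdom c x -> (\forall y \near x, P y) ->
  \forall w \near c x, exists y, [/\ cdom c y, P y & c y = w].
Proof.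
rewrite -nbhs_nearE nbhsE => cx -[A [oA Ax] AP].
have [oc _ _ /(_ (A `&` cdom c)) op] := hc.
have oO' : open (c @` (A `&` cdom c)) by apply: op => [|y []//]; exact: openI.
apply: filterS (open_nbhs_nbhs (conj oO' _)); last by exists x.
by move=> w [y [Ay cy] <-]; exists y; split=> //; exact: AP.
Qed.

Lemma chart_near x (P : 'rV[R]_n -> Prop) : cdom c x ->
  (\forall y \near x, P (c y)) -> \forall w \near c x, P w.
Proof.
by move=> cx /(chart_open_near cx); apply: filterS => w [y [_ Py <-]].
Qed.

Lemma chart_pullback x (P : 'rV[R]_n -> Prop) : cdom c x ->
  (\forall w \near c x, P w) -> \forall y \near x, P (c y).
Proof. by move=> /chart_cont; exact. Qed.

End Chart.

Section LocalRep.
Context {m n : nat} {M : smooth_space R m} {N : smooth_space R n}.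

Lemma local_rep_val (f : M -> N) c d x g : local_rep f c d x g -> d (f x) = g (c x).
Proof. by case=> _ _ /nbhs_singleton[]. Qed.

Lemma local_rep_dom (f : M -> N) c d x g : local_rep f c d x g -> cdom d (f x).
Proof. by case=> _ _ /nbhs_singleton[]. Qed.

(** Continuity is a consequence because [local_rep] asks [f] to stay, near [x], in the domain of
    [d], and [d] is injective and open there. *)
Lemma local_rep_cont (f : M -> N) c d x g : homeo_chart c -> homeo_chart d ->
  local_rep f c d x g -> {for x, continuous f}.
Proof.
move=> hc hd lr; have dfx := local_rep_dom lr; have E := local_rep_val lr.
have [cx sg fx] := lr => P /= Pfx.
have := chart_open_near hd dfx Pfx; rewrite E => /(smooth_near_cont sg) gP.
have := chart_pullback hc cx gP; rewrite /= => cP.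
apply: filterS2 cP fx => y [z [dz Pz zE]] [dfy dE].
by rewrite /= (_ : f y = z)//; apply: (chart_inj hd) => //; rewrite dE zE.
Qed.

Lemma local_rep_near_eq (f f' : M -> N) c d x g : (\forall y \near x, f y = f' y) ->
  local_rep f c d x g -> local_rep f' c d x g.
Proof.
move=> ff' [cx sg fg]; split=> //.
by apply: filterS2 ff' fg => y <-.
Qed.

Lemma local_rep_unique (f f' : M -> N) c d x g g' : homeo_chart c ->
  (\forall y \near x, f y = f' y) ->
  local_rep f c d x g -> local_rep f' c d x g' -> \forall w \near c x, g w = g' w.
Proof.
move=> hc ff' [cx sg fg] [_ _ fg']; apply: (chart_near hc cx).
near=> y; have [_ <-] : cdom d (f y) /\ d (f y) = g (c y) by near: y.
have [_ <-] : cdom d (f' y) /\ d (f' y) = g' (c y) by near: y.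
by congr (d _); near: y.
Unshelve. all: by end_near. Qed.

Lemma local_rep_near (f : M -> N) c d x g : homeo_chart c -> local_rep f c d x g ->
  \forall y \near x, local_rep f c d y g.
Proof.
move=> hc [cx sg fg].
have := chart_pullback hc cx (smooth_near_near sg); rewrite /= => sg'.
have := chart_dom_near hc cx => cx'.
near=> y; split; near: y => //.
exact: nbhs_interior fg.
Unshelve. all: by end_near. Qed.

End LocalRep.

Lemma local_rep_comp l m n (L : smooth_space R l) (M : smooth_space R m) (N : smooth_space R n)
    (f : L -> M) (h : M -> N) c d e x g k :
  homeo_chart c -> homeo_chart d ->
  local_rep f c d x g -> local_rep h d e (f x) k -> local_rep (h \o f) c e x (k \o g).
Proof.
move=> hc hd lf; have := local_rep_cont hc hd lf => cf.
have E := local_rep_val lf; have [cx sg fg] := lf; rewrite /local_rep => -[dfx sk].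
move=> /cf hk; split=> //; first by apply: smooth_near_comp => //; rewrite -E.
by apply: filterS2 fg hk => y [dfy fgy] /= [? ->]; rewrite fgy.
Qed.

Lemma local_rep_id n (M : smooth_space R n) (c : chart R M n) x : homeo_chart c ->
  cdom c x -> local_rep (@id M) c c x id.
Proof.
move=> hc cx; split=> //; first exact: smooth_near_id.
by have := chart_dom_near hc cx; apply: filterS.
Qed.

(** Maximality compares a chart only with the members of [charts M], so the transition goes through
    such a member at [x]. *)
Lemma maximal_transition n (M : smooth_space R n) (c d : chart R M n) x : premanifold M ->
  maximal_charts c -> maximal_charts d -> cdom c x -> cdom d x ->
  exists g, local_rep (@id M) c d x g.
Proof.
move=> [cov sub] mc md cx dx; have [e Me ex] := cov x.
have [g1 r1] := ((mc.2 _ Me).1 _ cx ex); have [g2 r2] := ((md.2 _ Me).2 _ ex dx).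
exists (g2 \o g1); apply: (local_rep_comp _ _ r1 r2); first exact: mc.1.
exact: (sub _ Me).1.
Qed.

Section SmoothAt.
Context {m n : nat} {M : smooth_space R m} {N : smooth_space R n}.
Hypotheses (pM : premanifold M) (pN : premanifold N).

Lemma local_rep_change (f : M -> N) (c c' : chart R M m) (d d' : chart R N n) x g :
  maximal_charts c -> maximal_charts d ->
  maximal_charts c' -> maximal_charts d' ->
  cdom c' x -> cdom d' (f x) -> local_rep f c d x g ->
  exists t1 t2, [/\ local_rep (@id M) c' c x t1, local_rep (@id N) d d' (f x) t2 &
                local_rep f c' d' x (t2 \o (g \o t1))].
Proof.
move=> mc md mc' md' c'x d'fx lr; have [cx _ _] := lr.
have [t1 r1] := maximal_transition pM mc' mc c'x cx.
have [t2 r2] := maximal_transition pN md md' (local_rep_dom lr) d'fx.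
exists t1, t2; split=> //.
apply: (@local_rep_comp _ _ _ _ _ _ f id c' d) => //; [exact: mc'.1|exact: md.1|].
by apply: (@local_rep_comp _ _ _ _ _ _ id f c' c) => //; [exact: mc'.1|exact: mc.1].
Qed.

Lemma smooth_at_rep (f : M -> N) x (c : chart R M m) (d : chart R N n) : smooth_at f x ->
  maximal_charts c -> maximal_charts d -> cdom c x -> cdom d (f x) ->
  exists g, local_rep f c d x g.
Proof.
move=> [c0 [d0 [g [Mc Nd lr]]]] mc md cx dfx.
have [t1 [t2 [_ _ r]]] := local_rep_change (charts_maximal pM Mc)
  (charts_maximal pN Nd) mc md cx dfx lr.
by eexists; exact: r.
Qed.

Lemma smooth_atI (f : M -> N) x (c : chart R M m) (d : chart R N n) g :
  maximal_charts c -> maximal_charts d ->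
  local_rep f c d x g -> smooth_at f x.
Proof.
move=> mc md lr; have [c0 Mc c0x] := pM.1 x; have [d0 Nd d0x] := pN.1 (f x).
have [t1 [t2 [_ _ r]]] := local_rep_change mc md (charts_maximal pM Mc)
  (charts_maximal pN Nd) c0x d0x lr.
by exists c0, d0; eexists; split=> //; exact: r.
Qed.

Lemma smooth_at_cont (f : M -> N) x : smooth_at f x -> {for x, continuous f}.
Proof.
move=> [c [d [g [Mc Nd]]]]; apply: local_rep_cont; apply: maximal_homeo;
  exact: charts_maximal.
Qed.

Lemma smooth_at_near_eq (f f' : M -> N) x : (\forall y \near x, f y = f' y) ->
  smooth_at f x -> smooth_at f' x.
Proof.
move=> ff' [c [d [g [Mc Nd lr]]]]; exists c, d, g; split=> //.
exact: local_rep_near_eq lr.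
Qed.

Lemma smooth_at_near (f : M -> N) x : smooth_at f x -> \forall y \near x, smooth_at f y.
Proof.
move=> [c [d [g [Mc Nd lr]]]].
have hc := maximal_homeo (charts_maximal pM Mc).
by have := local_rep_near hc lr; apply: filterS => y r; exists c, d, g.
Qed.

End SmoothAt.

Lemma smooth_at_id n (M : smooth_space R n) x : premanifold M -> smooth_at (@id M) x.
Proof.
move=> pM; have [c Mc cx] := pM.1 x; exists c, c, id; split=> //.
by apply: local_rep_id => //; exact/maximal_homeo/charts_maximal.
Qed.

Lemma smooth_at_comp l m n (L : smooth_space R l) (M : smooth_space R m)
    (N : smooth_space R n) (f : L -> M) (h : M -> N) x :
  premanifold L -> premanifold M -> premanifold N ->
  smooth_at h (f x) -> smooth_at f x -> smooth_at (h \o f) x.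
Proof.
move=> pL pM pN [d [e [k [Md Ne lh]]]] sf.
have [c Lc cx] := pL.1 x; have [dfx _ _] := lh.
have mc := charts_maximal pL Lc; have md := charts_maximal pM Md.
have [g lf] := smooth_at_rep pL pM sf mc md cx dfx.
apply: (smooth_atI pL pN mc (charts_maximal pN Ne) (local_rep_comp _ _ lf lh)).
  exact: maximal_homeo.
exact: maximal_homeo.
Qed.

Section LeftInverse.
Context {m n : nat} {M : smooth_space R m} {N : smooth_space R n}.
Hypotheses (pM : premanifold M) (pN : premanifold N).

(** By the chain rule the differential of a smooth left inverse is a left inverse of the
    differential. *)
Lemma left_inverse_immersion (f : M -> N) (h : N -> M) x : smooth_at f x ->
  smooth_at h (f x) -> (\forall y \near x, h (f y) = y) -> immersion_at f x.
Proof.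
move=> [c [d [g [Mc Nd lf]]]] sh hf.
have mc := charts_maximal pM Mc; have md := charts_maximal pN Nd.
have hfx : h (f x) = x by exact: nbhs_singleton hf.
have [cx sg _] := lf; have E := local_rep_val lf.
have [k lh] := smooth_at_rep pN pM sh md mc (local_rep_dom lf) (eq_ind_r (cdom c) cx hfx).
have lhf := local_rep_comp mc.1 md.1 lf lh.
have kg := local_rep_unique mc.1 hf lhf (local_rep_id mc.1 cx).
exists c, d, g; split=> // u v uv.
have sk : smooth_near k (g (c x)) by rewrite -E; case: lh.
have D w : 'd k (g (c x)) ('d g (c x) w) = w.
  have -> : 'd k (g (c x)) ('d g (c x) w) = 'd (k \o g) (c x) w.
    rewrite (diff_comp (smooth_near_diff sg) (smooth_near_diff sk)) //.
  rewrite -deriveE; last exact: differentiable_comp (smooth_near_diff sg) (smooth_near_diff sk).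
  by rewrite (near_eq_derive _ kg) derive_id.
by rewrite -(D u) uv D.
Qed.

End LeftInverse.

End Premanifold.

(** * Local diffeomorphisms and their inverses *)

Section Diffeo.
Context {R : realType}.

Section InversePair.
Context {m n : nat} {M : smooth_space R m} {N : smooth_space R n}.
Hypotheses (pM : premanifold M) (pN : premanifold N).

(** A germ of a diffeomorphism that carries its inverse along. Unlike [local_diffeo] it names no
    domain, so composing does not require intersecting open sets. *)
Definition inverse_pair (F : M -> N) (G : N -> M) x :=
  [/\ smooth_at F x, smooth_at G (F x), \forall y \near x, G (F y) = y &
      \forall z \near F x, F (G z) = z].

Lemma inverse_pairK F G x : inverse_pair F G x -> G (F x) = x.
Proof. by case=> _ _ /nbhs_singleton. Qed.

Lemma inverse_pair_near F G x : inverse_pair F G x -> \forall y \near x, inverse_pair F G y.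
Proof.
move=> [sF sG GF FG]; have cF := smooth_at_cont pM pN sF.
have sF' := smooth_at_near pM sF.
have sG' := cF _ (smooth_at_near pN sG).
have FG' := cF _ (nbhs_interior FG).
have GF' := nbhs_interior GF.
near=> y; split; by near: y.
Unshelve. all: by end_near. Qed.

Lemma inverse_pair_near_eq F F' G x : (\forall y \near x, F y = F' y) ->
  inverse_pair F G x -> inverse_pair F' G x.
Proof.
move=> FF' p; have K := inverse_pairK p; have [sF sG GF FG] := p.
have Fx : F x = F' x by exact: nbhs_singleton FF'.
split.
- exact: smooth_at_near_eq sF.
- by rewrite -Fx.
- by apply: filterS2 FF' GF => y <-.
- rewrite -Fx; have cG : G @ F x --> G (F x) := smooth_at_cont pN pM sG.
  rewrite K in cG; have := cG _ FF'.
  by apply: filterS2 FG => z E /= <-.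
Qed.

End InversePair.

Lemma inverse_pair_sym m n (M : smooth_space R m) (N : smooth_space R n)
    (F : M -> N) (G : N -> M) x : inverse_pair F G x -> inverse_pair G F (F x).
Proof. by move=> p; rewrite /inverse_pair (inverse_pairK p); case: p. Qed.

Section Equidim.
Context {m : nat} {M N : smooth_space R m}.
Hypotheses (pM : premanifold M) (pN : premanifold N).

Lemma immersion_inverse_pair (f : M -> N) x : immersion_at f x ->
  exists G, inverse_pair f G x.
Proof.
move=> [c [d [g [Mc Nd lf ig]]]].
have hc := maximal_homeo (charts_maximal pM Mc).
have hd := maximal_homeo (charts_maximal pN Nd).
have E := local_rep_val lf; have dfx := local_rep_dom lf.
have cf := local_rep_cont hc hd lf.
have [cx sg fg] := lf; have [gi [sgi gig ggi]] := inverse_function sg ig.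
have gix : gi (g (c x)) = c x by exact: nbhs_singleton gig.
(* [G] is [gi] read in the charts. A chart comes without an inverse map, so a preimage is chosen;
   the default [x] matters only away from [f x]. *)
pose G v := xget x [set y | cdom c y /\ c y = gi (d v)].
have GP : \forall v \near f x, cdom c (G v) /\ c (G v) = gi (d v).
  have cgi : gi @ g (c x) --> gi (g (c x)) := smooth_near_cont sgi.
  rewrite gix in cgi.
  have xT : \forall y \near x, setT y by exact: filterT.
  have op : \forall w \near d (f x), exists y, [/\ cdom c y, setT y & c y = gi w].
    by rewrite E; exact: cgi _ (chart_open_near hc cx xT).
  have := chart_pullback hd dfx op; apply: filterS => v [y [cy _ yE]].
  by rewrite /G; case: xgetP => [z _ //|/(_ y)]; case.
have Gfx : G (f x) = x.
  have [cG EG] := nbhs_singleton GP; apply: (chart_inj hc) => //.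
  by rewrite EG E gix.
have lG : local_rep G d c (f x) gi by split=> //; rewrite E.
have cG : G @ f x --> G (f x) := local_rep_cont hd hc lG; rewrite Gfx in cG.
exists G; split.
- by exists c, d, g.
- by exists d, c, gi.
- have cx' := chart_dom_near hc cx.
  have gic := chart_pullback hc cx gig; rewrite /= in gic.
  have cGP := cf _ GP; rewrite /= in cGP.
  near=> y; have [cGy EG] : cdom c (G (f y)) /\ c (G (f y)) = gi (d (f y)) by near: y.
  have [_ fy] : cdom d (f y) /\ d (f y) = g (c y) by near: y.
  apply: (chart_inj hc) => //; first by near: y.
  by rewrite EG fy; near: y.
- have dz := chart_dom_near hd dfx.
  rewrite -E in ggi; have ggd := chart_pullback hd dfx ggi; rewrite /= in ggd.
  have fgG := cG _ fg; rewrite /= in fgG.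
  near=> z; have [dfG fGE] : cdom d (f (G z)) /\ d (f (G z)) = g (c (G z)) by near: z.
  have [_ EG] : cdom c (G z) /\ c (G z) = gi (d z) by near: z.
  apply: (chart_inj hd) => //; first by near: z.
  by rewrite fGE EG; near: z.
Unshelve. all: by end_near. Qed.

End Equidim.

Lemma inverse_pair_comp l m n (L : smooth_space R l) (M : smooth_space R m)
    (N : smooth_space R n) (f : L -> M) fi (h : M -> N) hi x :
  premanifold L -> premanifold M -> premanifold N ->
  inverse_pair f fi x -> inverse_pair h hi (f x) ->
  inverse_pair (h \o f) (fi \o hi) x.
Proof.
move=> pL pM pN pf ph; have Kf := inverse_pairK pf; have Kh := inverse_pairK ph.
have [sf sfi fif ffi] := pf; have [sh shi hih hhi] := ph.
have cf := smooth_at_cont pL pM sf; have ch := smooth_at_cont pM pN sh.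
have chi : hi @ h (f x) --> hi (h (f x)) := smooth_at_cont pN pM shi.
split.
- exact: smooth_at_comp.
- by apply: smooth_at_comp => //=; rewrite Kh.
- have := cf _ hih; rewrite /=; apply: filterS2 fif => y fy hfy.
  by rewrite /= hfy.
- rewrite Kh in chi; have := chi _ ffi; rewrite /=.
  by apply: filterS2 hhi => z hz /= ->.
Qed.

(** * Submanifolds as manifolds *)

Section SubSpace.
Context {n k : nat} {M : smooth_space R n} (V : set M).
Hypotheses (pM : premanifold M) (sV : submanifold k V).

(** [T] truncates R^n to R^k and [E] embeds R^k as R^k x 0; as matrices they are smooth at once, and
    the slice condition becomes an equation between products. *)
Let T : 'M[R]_(n, k) := pid_mx k.
Let E : 'M[R]_(k, n) := pid_mx k.
Local Notation S := (sub_space k V).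

Let kn : (k <= n)%N. Proof. by case: sV. Qed.

Lemma trunc_coord (u : 'rV[R]_n) (kn' : (k <= n)%N) :
  u *m T = \row_i u 0 (widen_ord kn' i).
Proof.
apply/rowP => i; rewrite !mxE (bigD1 (widen_ord kn' i))//= !mxE /= eqxx ltn_ord mulr1.
rewrite big1 ?addr0// => j; rewrite -val_eqE /= => ji; rewrite !mxE.
by rewrite (negbTE ji) mulr0.
Qed.

Lemma embedK (w : 'rV[R]_k) : w *m E *m T = w.
Proof. by rewrite -mulmxA /E /T pid_mx_id// pid_mx_1 mulmx1. Qed.

Lemma slice_condP (u : 'rV[R]_n) : (forall i : 'I_n, (k <= i)%N -> u 0 i = 0) <->
  u *m T *m E = u.
Proof.
rewrite -mulmxA /T /E pid_mx_id//.
have uE i : (u *m (pid_mx k : 'M[R]_n)) 0 i = u 0 i * (i < k)%:R.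
  rewrite mxE (bigD1 i)//= !mxE eqxx /= big1 ?addr0// => j ji; rewrite !mxE.
  by rewrite -val_eqE in ji; rewrite (negbTE ji) mulr0.
split=> [u0|uu i ki].
  apply/rowP => i; rewrite uE; case: ltnP => [_|/u0 ->]; first by rewrite mulr1.
  by rewrite mulr0.
by rewrite -uu uE ltnNge ki mulr0.
Qed.

Definition slice_restr (c : chart R M n) : chart R S k :=
  Chart (set_val @^-1` cdom c : set S) (fun y : S => c (set_val y) *m T).

Lemma slice_restr_sub c : slice_chart k V c -> charts S (slice_restr c).
Proof.
by move=> sc; exists kn, c; split=> // y _ /=; exact: trunc_coord.
Qed.

Lemma sub_chartP (e : chart R S k) : charts S e -> exists c : chart R M n,
  [/\ maximal_charts c, forall y, cdom c y -> (V y <-> c y *m T *m E = c y),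
      cdom e = set_val @^-1` cdom c & forall y, cdom e y -> e y = c (set_val y) *m T].
Proof.
move=> [kn' [c [[mc sc] de eE]]]; exists c; split=> //.
  by move=> y cy; split=> [/(sc y cy)/slice_condP//|/slice_condP/(sc y cy)].
by move=> y ey; rewrite (trunc_coord _ kn'); exact: eE.
Qed.

Lemma set_val_cont : continuous (set_val : S -> M).
Proof. exact: initial_continuous. Qed.

Lemma sub_nbhs (x : S) (P : S -> Prop) : nbhs x P ->
  exists B, [/\ open B, B (set_val x) & forall y : S, B (set_val y) -> P y].
Proof.
rewrite nbhsE => -[A [[B oB <-] Bx] AP]; exists B; split=> // y By; exact: AP.
Qed.

Lemma sub_chart_homeo (e : chart R S k) : charts S e -> homeo_chart e.
Proof.
move=> /sub_chartP[c [mc cV de eE]]; have [oc ci cc cop] := mc.1.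
have cE y : cdom e y -> c (set_val y) = e y *m E.
  move=> ey; rewrite eE//; apply/esym/cV; last exact: set_valP.
  by rewrite de in ey.
have oe : open (cdom e).
  by rewrite de; apply: open_comp => // y _; exact: set_val_cont.
split=> //.
- move=> y z /set_mem ey /set_mem ez yz; apply: val_inj.
  apply: ci; [by rewrite de in ey; apply/mem_set|by rewrite de in ez; apply/mem_set|].
  by rewrite (cE _ ey) (cE _ ez) yz.
- move=> y /set_mem ey; have cy : cdom c (set_val y) by rewrite de in ey.
  have : {for y, continuous (mulmx^~ T \o (c \o set_val))}.
    apply: continuous_comp; last exact: smooth_near_cont (smooth_near_mulmx _ _).
    by apply: continuous_comp; [exact: set_val_cont|exact/cc/mem_set].
  move=> cT P; rewrite eE// => /cT.
  have : \forall z \near y, cdom e z by exact: open_nbhs_nbhs.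
  by apply: filterS2 => z ez /=; rewrite eE.
- move=> A [B oB <-] Be.
  (* By the slice condition, a point of the chart domain with coordinates in the image of [E] lies
     in [V]; so the image is the preimage under [E] of an open set of R^n. *)
  have -> : e @` (set_val @^-1` B) = mulmx^~ E @^-1` (c @` (B `&` cdom c)).
    apply/seteqP; split=> [_ [y By <-]|w [z [Bz cz] zw]] /=.
      exists (set_val y); last exact/cE/Be.
      by split=> //; have := Be _ By; rewrite de.
    have Vz : V z by apply/cV => //; rewrite zw embedK.
    pose y : S := exist _ z (mem_set Vz).
    have ey : cdom e y by rewrite de.
    by exists y => //; rewrite eE//= zw embedK.
  apply: open_comp => [w _|]; first exact: smooth_near_cont (smooth_near_mulmx _ _).
  by apply: cop => [|z []//]; exact: openI.
Qed.

Lemma sub_premanifold : premanifold S.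
Proof.
split=> [x|e Se].
  have [c sc cx] := sV.2 _ (set_valP x).
  by exists (slice_restr c); [exact: slice_restr_sub|].
split; first exact: sub_chart_homeo.
suff tr e1 e2 : charts S e1 -> charts S e2 -> smooth_transition e1 e2.
  by move=> d Sd; split; exact: tr.
move=> Se1 Se2 x e1x e2x.
have he1 := sub_chart_homeo Se1; have he2 := sub_chart_homeo Se2.
have [c1 [mc1 cV1 de1 eE1]] := sub_chartP Se1.
have [c2 [mc2 cV2 de2 eE2]] := sub_chartP Se2.
have c1x : cdom c1 (set_val x) by rewrite de1 in e1x.
have c2x : cdom c2 (set_val x) by rewrite de2 in e2x.
have [t [_ st tE]] := maximal_transition pM mc1 mc2 c1x c2x.
have cE y : cdom e1 y -> c1 (set_val y) = e1 y *m E.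
  move=> ey; rewrite eE1//; apply/esym/cV1; last exact: set_valP.
  by rewrite de1 in ey.
exists (mulmx^~ T \o (t \o mulmx^~ E)); split=> //.
  apply: smooth_near_comp; first exact: smooth_near_mulmx.
  apply: smooth_near_comp; last exact: smooth_near_mulmx.
  by rewrite -cE.
have tE' := set_val_cont tE; rewrite /= in tE'.
have e1n := chart_dom_near he1 e1x; have e2n := chart_dom_near he2 e2x.
near=> y; have e1y : cdom e1 y by near: y.
have e2y : cdom e2 y by near: y.
split=> //; rewrite eE2//= -cE//; congr (_ *m _).
by have [] : cdom c2 (set_val y) /\ c2 (set_val y) = t (c1 (set_val y)) by near: y.
Unshelve. all: by end_near. Qed.

(** In a slice chart, truncating the coordinates retracts onto the slice. This gives left inverses
    of inclusions and allows smoothness of maps into [V] to be tested in [M]. *)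
Lemma sub_retraction (x : S) : exists r : M -> S, [/\ smooth_at (set_val : S -> M) x,
  smooth_at r (set_val x) & \forall y \near x, r (set_val y) = y].
Proof.
have [c sc cx] := sV.2 _ (set_valP x); pose e := slice_restr c.
have Se : charts S e by exact: slice_restr_sub.
have he := sub_chart_homeo Se; have pS := sub_premanifold.
have mc : maximal_charts c by case: sc.
have ex : cdom e x by [].
have cE y : cdom e y -> c (set_val y) = e y *m E.
  move=> ey; apply/esym/slice_condP => i ki.
  by case: sc => _ /(_ _ ey)[/(_ (set_valP y))/(_ i ki)].
pose r v := xget x [set y : S | cdom e y /\ e y = c v *m T].
have rP : \forall v \near set_val x, cdom e (r v) /\ e (r v) = c v *m T.
  have xT : \forall y \near x, setT y by exact: filterT.
  have op' : \forall w \near c (set_val x), exists y, [/\ cdom e y, setT y & e y = w *m T].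
    exact: (smooth_near_cont (smooth_near_mulmx T (c (set_val x)))) _ (chart_open_near he ex xT).
  have := chart_pullback mc.1 cx op'.
  apply: filterS => v [y [ey _ yE]].
  by rewrite /r; case: xgetP => [z _ //|/(_ y)]; case.
exists r; split.
- apply: (smooth_atI pS pM (charts_maximal pS Se) mc (g := mulmx^~ E)); split=> //.
    exact: smooth_near_mulmx.
  by have := chart_dom_near he ex; apply: filterS => y ey; split=> //; exact: cE.
- apply: (smooth_atI pM pS mc (charts_maximal pS Se) (g := mulmx^~ T)); split=> //.
  exact: smooth_near_mulmx.
- have := set_val_cont rP; rewrite /= => rP'.
  have en := chart_dom_near he ex.
  near=> y.
  have [er rE] : cdom e (r (set_val y)) /\ e (r (set_val y)) = c (set_val y) *m T.
    by near: y.
  by apply: (chart_inj he) => //; near: y.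
Unshelve. all: by end_near. Qed.

(** Near [x], [f] is [r \o (set_val \o f)] for a local retraction [r]. Staying where [r] retracts
    needs continuity of [f], which the initial topology provides. *)
Lemma sub_corestrict l (L : smooth_space R l) (f : L -> S) x : premanifold L ->
  smooth_at (set_val \o f : L -> M) x -> smooth_at f x.
Proof.
move=> pL sf; have pS := sub_premanifold.
have [r [_ sr rK]] := sub_retraction (f x).
have cf : {for x, continuous f}.
  move=> P /sub_nbhs[B [oB Bfx BP]].
  have cB := smooth_at_cont pL pM sf (open_nbhs_nbhs (conj oB Bfx)).
  exact: (filterS (fun y By => BP (f y) By) cB).
have srf : smooth_at (r \o (set_val \o f)) x.
  exact: (smooth_at_comp (h := r) (f := set_val \o f) pL pM pS).
exact: (smooth_at_near_eq (cf _ rK) srf).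
Qed.

End SubSpace.
End Diffeo.

(** * Coproducts *)

Section Coproduct.
Context {R : realType} {n : nat} {I : choiceType} {M : I -> smooth_space R n}.
Hypothesis pM : forall i, premanifold (M i).
Local Notation inj i := (existT (fun i => M i : Type) i : M i -> coprod M).

(** A total left inverse of the injection of component [i], so that the two form an [inverse_pair];
    the value [x0] on other components is arbitrary. *)
Definition coproj i (x0 : M i) (p : coprod M) : M i := untag x0 id p.

Lemma coprojK i x0 : cancel (inj i) (coproj x0).
Proof. by move=> y; rewrite /coproj untagE. Qed.

Lemma coprod_chartP (e : chart R (coprod M) n) i x : charts (coprod M) e ->
  cdom e (inj i x) -> exists c : chart R (M i) n,
  [/\ charts (M i) c, cdom c x, cdom e = inj i @` cdom c
    & forall y, cdom c y -> e (inj i y) = c y].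
Proof.
move=> [j [c [Mc de eE]]]; rewrite de => -[z cz zx].
have ij := existT_inj1 zx; subst j; exists c; split=> //.
by rewrite -(existT_inj2 zx).
Qed.

(** Holds by conversion, so later steps change freely between a component and the coproduct. *)
Lemma coprod_nbhs i (x : M i) (P : coprod M -> Prop) :
  (\forall y \near x, P (inj i y)) <-> nbhs (inj i x) P.
Proof. by []. Qed.

Lemma coprod_chart_homeo (e : chart R (coprod M) n) : charts (coprod M) e -> homeo_chart e.
Proof.
move=> [i [c [Mc de eE]]]; have [oc ci cc cop] := maximal_homeo (charts_maximal (pM i) Mc).
split.
- by rewrite de; exact: existT_open_map.
- move=> p q; rewrite de => /set_mem[y cy <-] /set_mem[z cz <-]; rewrite !eE// => yz.
  by congr existT; apply: ci => //; exact/mem_set.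
- move=> p; rewrite de => /set_mem[y cy <-] P; rewrite eE//.
  move=> /(cc _ (mem_set cy)) Py; apply/coprod_nbhs.
  have cz : \forall z \near y, cdom c z by exact: open_nbhs_nbhs.
  have {}Py : \forall z \near y, P (c z) by exact: Py.
  by apply: filterS2 Py cz => z Pz cz; rewrite /= eE.
- move=> A oA Ae; have -> : e @` A = c @` (inj i @^-1` A).
    apply/seteqP; split=> [_ [p Ap <-]|_ [y Ay <-]]; last first.
      have : cdom e (inj i y) by exact: Ae.
      rewrite de => -[z cz zE]; have zy := existT_inj2 zE.
      by exists (inj i y) => //; rewrite eE// -zy.
    have := Ae _ Ap; rewrite de => -[z cz zp].
    by exists z; rewrite /= ?zp// -eE// zp.
  apply: cop; first by have /sigT_openP := oA; exact.
  move=> y /Ae; rewrite de => -[z cz zE]; by rewrite -(existT_inj2 zE).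
Qed.

Lemma coprod_premanifold : premanifold (coprod M).
Proof.
split=> [[i x]|e Me].
  have [c Mc cx] := (pM i).1 x.
  exists (Chart (inj i @` cdom c) (c \o coproj x)); last by exists x.
  by exists i, c; split=> // y cy /=; rewrite coprojK.
split; first exact: coprod_chart_homeo.
suff tr e1 e2 : charts (coprod M) e1 -> charts (coprod M) e2 -> smooth_transition e1 e2.
  by move=> d Md; split; exact: tr.
move=> M1 M2 [i x] e1x e2x.
have [c1 [Mc1 c1x d1 E1]] := coprod_chartP M1 e1x.
have [c2 [Mc2 c2x d2 E2]] := coprod_chartP M2 e2x.
have m1 := charts_maximal (pM i) Mc1; have m2 := charts_maximal (pM i) Mc2.
have [t [_ st tE]] := maximal_transition (pM i) m1 m2 c1x c2x.
exists t; split=> //; first by rewrite E1.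
apply/coprod_nbhs; have := chart_dom_near m1.1 c1x.
apply: filterS2 tE => y [c2y yE] c1y.
by split; [rewrite d2; exists y|rewrite E1// E2].
Qed.

Lemma coprod_inverse_pair i (x0 x : M i) : inverse_pair (inj i) (coproj x0) x.
Proof.
have [c Mc cx] := (pM i).1 x.
pose e : chart R (coprod M) n := Chart (inj i @` cdom c) (c \o coproj x0).
have Me : charts (coprod M) e.
  by exists i, c; split=> // y cy /=; rewrite coprojK.
have hc := maximal_homeo (charts_maximal (pM i) Mc).
have cn := chart_dom_near hc cx.
split.
- exists c, e, id; split=> //; split=> //; first exact: smooth_near_id.
  by apply: filterS cn => y cy; split; [exists y|rewrite /= coprojK].
- exists e, c, id; split=> //; split; first by exists x.
    exact: smooth_near_id.
  by apply/coprod_nbhs; apply: filterS cn => y cy; rewrite /= coprojK.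
- by apply: nearW => y; exact: coprojK.
- by apply/coprod_nbhs; apply: nearW => y; rewrite /= coprojK.
Qed.

End Coproduct.

(** * Germs of orbit-preserving maps *)

Section Hausdorff.

Lemma sub_hausdorff (T : topologicalType) (V : set T) :
  hausdorff_space T -> hausdorff_space (set_type V).
Proof.
move=> hT p q pq; apply: val_inj; apply: hT => A B pA qB.
have sc : continuous (set_val : V -> T) by exact: initial_continuous.
by have [z [Az Bz]] := pq _ _ (sc _ _ pA) (sc _ _ qB); exists (set_val z).
Qed.

Lemma neq_near (S T : topologicalType) (f h : S -> T) x : hausdorff_space T ->
  {for x, continuous f} -> {for x, continuous h} -> f x <> h x ->
  \forall y \near x, f y <> h y.
Proof.
move=> hT cf ch fh; apply: contrapT => nn; apply: fh; apply: hT => A B fA hB.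
apply: contrapT => AB; apply: nn.
have {}fA : \forall y \near x, A (f y) by exact: cf _ fA.
have {}hB : \forall y \near x, B (h y) by exact: ch _ hB.
by apply: filterS2 fA hB => y Ay By E; apply: AB; exists (f y); split=> //; rewrite E.
Qed.

End Hausdorff.

Section FiniteAction.
Context {R : realType} {m : nat} {V : smooth_space R m}.
Hypotheses (pV : premanifold V) (hV : hausdorff_space V).
Context {gT : finGroupType} (D : {group gT}) (act : gT -> V -> V).
Hypothesis act1 : forall x, act 1%g x = x.
Hypothesis actM : forall a b x, a \in D -> b \in D -> act (a * b)%g x = act a (act b x).
Hypothesis act_smooth : forall a, a \in D -> smooth_map (act a).

(** The derivatives agree on open sets accumulating at [y], hence at [y] because they are
    continuous. *)
Lemma derive_accum (f h : V -> V) (c : chart R V m) y fr hr : charts V c ->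
  local_rep f c c y fr -> local_rep h c c y hr ->
  (forall B, nbhs y B -> exists A, [/\ open A, A !=set0, A `<=` B & forall v, A v -> f v = h v]) ->
  forall u, 'D_u fr (c y) = 'D_u hr (c y).
Proof.
move=> Vc lf lh acc u; have hc := maximal_homeo (charts_maximal pV Vc).
have [cy sf _] := lf; have [_ sh _] := lh.
apply: contrapT => neq.
have neqn : \forall w \near c y, 'D_u fr w <> 'D_u hr w.
  pose F w : 'rV[R]_m := 'D_u fr w; pose H w : 'rV[R]_m := 'D_u hr w.
  have cF : {for c y, continuous F} by exact: smooth_near_derive_cont.
  have cH : {for c y, continuous H} by exact: smooth_near_derive_cont.
  exact: (@neq_near _ _ F H (c y) (@norm_hausdorff _ _) cF cH neq).
have neqV := chart_pullback hc cy neqn.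
have fn := local_rep_near hc lf; have hn := local_rep_near hc lh.
have [A [oA [v Av] AB fhA]] := acc _ (filterI neqV (filterI fn hn)).
have [nv [lfv lhv]] := AB _ Av; apply: nv.
apply: near_eq_derive; apply: (local_rep_unique hc _ lfv lhv).
have : \forall w \near v, A w by exact: open_nbhs_nbhs.
by apply: filterS.
Qed.

(* The sum of the powers of [a] in a chart is [a]-invariant, and a local
   diffeomorphism when [a] is tangent to the identity. *)
Lemma tangent_id_act a (c : chart R V m) y al : a \in D -> charts V c ->
  local_rep (act a) c c y al -> act a y = y -> (forall u, 'D_u al (c y) = u) ->
  \forall v \near y, act a v = v.
Proof.
move=> Da Vc la ay Dal; have mc := charts_maximal pV Vc; have hc := mc.1.
have [cy sal _] := la; have aly : al (c y) = c y by rewrite -(local_rep_val la) ay.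
have acty i : act (a ^+ i)%g y = y.
  by elim: i => [|i IH]; rewrite ?act1// expgS actM ?groupX// IH.
(* By the chain rule every power of [a] is tangent to the identity at [y], so the sum over [N]
   powers has derivative N times the identity, which is invertible. *)
have reps i : exists f, local_rep (act (a ^+ i)%g) c c y f /\ forall u, 'D_u f (c y) = u.
  elim: i => [|i [f [lf Df]]].
    exists id; split; last by move=> u; rewrite derive_id.
    by apply: local_rep_near_eq (local_rep_id hc cy); apply: nearW => v; rewrite act1.
  have fy : f (c y) = c y by rewrite -(local_rep_val lf) acty.
  have [_ sf _] := lf.
  exists (al \o f); split=> [|u].
    have la' : local_rep (act a) c c (act (a ^+ i)%g y) al by rewrite acty.
    apply: local_rep_near_eq (local_rep_comp hc hc lf la').
    by apply: nearW => v; rewrite expgS actM ?groupX.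
  have dal : differentiable al (f (c y)) by rewrite fy; exact: smooth_near_diff.
  have df := smooth_near_diff sf.
  rewrite deriveE; last exact: differentiable_comp.
  have E : 'd (al \o f) (c y) = 'd al (f (c y)) \o 'd f (c y) :> ('rV[R]_m -> 'rV[R]_m).
    exact: diff_comp.
  by rewrite E /= fy -!deriveE// ?Df ?Dal// -fy.
have [f_ f_P] := choice reps.
pose N := #[a]%g; have N0 : (0 < N)%N by exact: order_gt0.
pose phi w := \sum_(i < N) f_ i w.
have sphi : smooth_near phi (c y).
  by apply: smooth_near_sum => i; have [[]] := f_P i.
have Dphi u : 'd phi (c y) u = N%:R *: u.
  rewrite -deriveE; last exact: smooth_near_diff.
  have -> : phi = \sum_(i < N) (f_ i : 'rV[R]_m -> 'rV[R]_m).
    by apply/funext => w; rewrite fct_sumE.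
  rewrite derive_sum => [|i]; last first.
    by apply: diff_derivable; have [[_ /smooth_near_diff]] := f_P i.
  rewrite (eq_bigr (fun=> u)) => [|i _]; last by have [_ ->] := f_P i.
  by rewrite sumr_const card_ord scaler_nat.
have iphi : injective ('d phi (c y)).
  move=> u w; rewrite !Dphi => /scalerI; apply.
  by rewrite pnatr_eq0 -lt0n.
have [gi [_ giphi _]] := inverse_function sphi iphi.
have near1 : \forall v \near y, cdom c v /\ gi (phi (c v)) = c v /\
    forall i : 'I_N, c (act (a ^+ i)%g v) = f_ i (c v).
  apply: filterI; first exact: chart_dom_near.
  have gc := chart_pullback hc cy giphi; apply: filterI; first exact: gc.
  apply: (@filter_forall _ _ (fun (i : 'I_N) v => c (act (a ^+ i)%g v) = f_ i (c v)) (nbhs y)) => i.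
  by have [[_ _ lf] _] := f_P i; apply: filterS lf => v [].
have ca : act a @ y --> act a y.
  by apply: (smooth_at_cont pV pV); exact: act_smooth.
rewrite ay in ca.
have near2 : \forall v \near y, cdom c (act a v) /\ gi (phi (c (act a v))) = c (act a v) /\
    forall i : 'I_N, c (act (a ^+ i)%g (act a v)) = f_ i (c (act a v)) by exact: ca _ near1.
apply: filterS2 near1 near2 => v [cv [gv fv]] [cav [gav fav]].
apply: (chart_inj hc) => //; rewrite -gav -gv; congr gi.
(* Replacing [v] by [act a v] shifts the sum cyclically: the last exponent [N] gives the identity
   and takes the place of exponent 0. *)
have -> : phi (c (act a v)) = \sum_(i < N) c (act (a ^+ i.+1)%g v).
  apply: eq_bigr => i _; rewrite -fav expgSr actM ?groupX//.
have -> : phi (c v) = \sum_(i < N) c (act (a ^+ i)%g v) by apply: eq_bigr => i _.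
rewrite -(prednK N0) big_ord_recr [RHS]big_ord_recl /= prednK// addrC.
by rewrite expg_order expg0; congr (_ + _).
Qed.

Context (y : V) (g : V -> V).
Hypothesis faith : forall a, a \in D -> (\forall v \near y, act a v = v) -> a = 1%g.
Hypothesis sg : smooth_at g y.
Hypothesis gact : \forall v \near y, exists2 a, a \in D & g v = act a v.

(** Says that [y] lies in the closure of the interior of the set where [g] agrees with [act a]. *)
Let acc a := a \in D /\ forall B, nbhs y B ->
  exists A, [/\ open A, A !=set0, A `<=` B & forall v, A v -> g v = act a v].

Let good v := smooth_at g v /\ exists2 a, a \in D & g v = act a v.

Let good_near : \forall v \near y, good v.
Proof. by apply: filterI => //; exact: smooth_at_near. Qed.

(** Finite Baire argument: if no agreement set contained a nonempty open set, removing these closed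
    sets from [B] one at a time would leave a point at which [g] agrees with no element. *)
Let open_cover B : open B -> B !=set0 -> B `<=` good ->
  exists2 a, a \in D & exists A, [/\ open A, A !=set0, A `<=` B & forall v, A v -> g v = act a v].
Proof.
move=> oB B0 Bg; apply: contrapT => none.
have shrink (s : seq gT) : exists A, [/\ open A, A !=set0, A `<=` B &
    forall a v, a \in s -> a \in D -> A v -> g v <> act a v].
  elim: s => [|b s [A [oA A0 AB An]]]; first by exists B; split=> [||v|a v].
  have [Db|nDb] := boolP (b \in D); last first.
    exists A; split=> // a v; rewrite inE => /orP[/eqP ->|]; last exact: An.
    by rewrite (negbTE nDb).
  have [v [Av gv]] : exists v, A v /\ g v <> act b v.
    apply: contrapT => nv; apply: none; exists b => //; exists A; split=> // v Av.
    by apply: contrapT => gv; apply: nv; exists v.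
  have [sgv _] := Bg _ (AB _ Av).
  have := neq_near hV (smooth_at_cont pV pV sgv) (smooth_at_cont pV pV (act_smooth Db v)) gv.
  rewrite -nbhs_nearE nbhsE => -[A' [oA' A'v] A'n].
  exists (A `&` A'); split=> //; [exact: openI|by exists v|by move=> w [/AB]|].
  move=> a w; rewrite inE => /orP[/eqP -> _ [_ /A'n]//|sa Da [Aw _]]; exact: An.
have [A [_ [v Av] AB An]] := shrink (enum gT).
have [_ [a Da]] := Bg _ (AB _ Av); apply: An => //.
by rewrite mem_enum.
Qed.

(** As the group is finite, one neighbourhood of [y] excludes all elements outside [acc]. *)
Let not_acc_near : exists B, nbhs y B /\ forall a, a \in D -> ~ acc a ->
  ~ exists A, [/\ open A, A !=set0, A `<=` B & forall v, A v -> g v = act a v].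
Proof.
have ex a : exists B, nbhs y B /\ (a \in D -> ~ acc a ->
    ~ exists A, [/\ open A, A !=set0, A `<=` B & forall v, A v -> g v = act a v]).
  have [aa|naa] := pselect (acc a); first by exists setT; split=> //; exact: filterT.
  have [Da|nDa] := boolP (a \in D); last by exists setT; split=> //; exact: filterT.
  apply: contrapT => nB; apply: naa; split=> // B yB; apply: contrapT => nA.
  by apply: nB; exists B; split.
have [B_ B_P] := choice ex.
exists (fun v => forall a, B_ a v); split.
  by apply: filter_forall => a; have [] := B_P a.
move=> a Da naa [A [oA A0 AB Ag]]; have [_ /(_ Da naa)] := B_P a; apply.
by exists A; split=> // v /AB/(_ a).
Qed.

Let acc_val a : acc a -> g y = act a y.
Proof.
move=> [Da aa]; apply: contrapT => neq.
have := neq_near hV (smooth_at_cont pV pV sg) (smooth_at_cont pV pV (act_smooth Da y)) neq.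
by move=> /aa[A [_ [v Av] AB Ag]]; apply: (AB _ Av); exact: Ag.
Qed.

(** The map [u], that is a^-1 g, links the two elements: it agrees with the identity on open sets
    accumulating at [y], and with a^-1 b on others. Having only one derivative at [y], it forces
    a^-1 b to be tangent to the identity. *)
Let acc_uniq a b : acc a -> acc b -> a = b.
Proof.
move=> aa ab; have ya := acc_val aa; have yb := acc_val ab.
have [Da accA] := aa; have [Db accB] := ab.
have Dai : (a^-1)%g \in D by rewrite groupV.
pose u v := act (a^-1)%g (g v); pose e := (a^-1 * b)%g.
have De : e \in D by rewrite groupM.
have aK v : act (a^-1)%g (act a v) = v by rewrite -actM// mulVg act1.
have uy : u y = y by rewrite /u ya aK.
have ey : act e y = y by rewrite actM// -yb ya aK.
have su : smooth_at u y.
  by apply: (smooth_at_comp (h := act (a^-1)%g) pV pV pV) => //; exact: act_smooth.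
have [c Vc cy] := pV.1 y; have mc := charts_maximal pV Vc.
have [ur lu] : exists ur, local_rep u c c y ur.
  by apply: (smooth_at_rep pV pV) => //; rewrite uy.
have [er le] : exists er, local_rep (act e) c c y er.
  by apply: (smooth_at_rep pV pV) => //; [exact: act_smooth|rewrite ey].
have E1 w : 'D_w ur (c y) = w.
  rewrite (derive_accum Vc lu (local_rep_id mc.1 cy)) ?derive_id// => B /accA.
  move=> [A [oA A0 AB Ag]]; exists A; split=> // v Av.
  by rewrite /u Ag// aK.
have E2 w : 'D_w er (c y) = w.
  rewrite -[RHS]E1; apply: (derive_accum Vc le lu) => B /accB.
  move=> [A [oA A0 AB Ag]]; exists A; split=> // v Av.
  by rewrite /u Ag// actM.
have := faith De (tangent_id_act De Vc le ey E2).
by move=> /(congr1 (mulg a)); rewrite mulKVg mulg1.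
Qed.

Lemma finite_action_germ : exists2 a, a \in D & \forall v \near y, g v = act a v.
Proof.
have [B [yB nB]] := not_acc_near.
have : nbhs y (B `&` good) by exact: filterI yB good_near.
rewrite nbhsE => -[B' [oB' B'y] B'B].
have Bg A : A `<=` B' -> A `<=` good by move=> AB v Av; exact: (B'B v (AB v Av)).2.
have BB v : B' v -> B v by move=> /B'B[].
have [a aa] : exists a, acc a.
  have [|a Da [A [oA A0 AB Ag]]] := open_cover oB' _ (Bg _ (fun _ => id)); first by exists y.
  exists a; apply: contrapT => naa; apply: (nB _ Da naa).
  by exists A; split=> // v /AB/BB.
have [Da _] := aa; exists a => //.
apply: filterS (open_nbhs_nbhs (conj oB' B'y)) => v B'v; apply: contrapT => neq.
have [sgv _] := Bg _ (fun _ => id) _ B'v.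
have := neq_near hV (smooth_at_cont pV pV sgv) (smooth_at_cont pV pV (act_smooth Da v)) neq.
rewrite -nbhs_nearE nbhsE => -[C [oC Cv] Cn].
(* Near [v], where [g] avoids [a], some [b] agrees with [g] on an open set; either [b] is [a] by
   [acc_uniq], or [b] was excluded by the choice of [B]. *)
have [||w|b Db [A [oA [w Aw] AB Ag]]] := @open_cover (B' `&` C).
- exact: openI.
- by exists v.
- by move=> [/(Bg _ (fun _ => id))].
have [ab|nab] := pselect (acc b).
  have E := acc_uniq aa ab; have [_ /Cn] := AB _ Aw; apply.
  by rewrite E; exact: Ag.
apply: (nB _ Db nab); exists A; split=> //; first by exists w.
by move=> z /AB[/BB].
Qed.

End FiniteAction.

(** * Germs over a space *)

Section Germs.
Context {R : realType}.

Lemma open_preimageI (S T : topologicalType) (A : set S) (B : set T) (f : S -> T) :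
  open A -> open B -> (forall x, A x -> {for x, continuous f}) -> open (A `&` f @^-1` B).
Proof.
move=> oA oB cf; rewrite openE => x [Ax Bfx]; apply: filterI.
  exact: open_nbhs_nbhs.
by apply: (cf _ Ax); exact: open_nbhs_nbhs.
Qed.

Lemma topological_embedding (S T : topologicalType) (f : S -> T) : continuous f ->
  (forall (A : set S) x, open A -> A x ->
     exists B, [/\ open B, B (f x) & f @^-1` B `<=` A]) ->
  forall A, open A <-> exists2 B, open B & A = f @^-1` B.
Proof.
move=> cf sep A; split=> [oA|[B oB ->]]; last by apply: open_comp => // x _; exact: cf.
exists (\bigcup_(B in [set B | open B /\ f @^-1` B `<=` A]) B).
  by apply: bigcup_open => B [].
apply/seteqP; split=> [x Ax|x [B [_ BA] Bfx]]; last exact: BA.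
by have [B [oB Bfx BA]] := sep _ _ oA Ax; exists B.
Qed.

Context {n : nat} {M : smooth_space R n} {X : Type} (pi : M -> X).
Hypothesis pM : premanifold M.

Definition over_germ (f : M -> M) p :=
  (exists G, inverse_pair f G p) /\ \forall q \near p, pi (f q) = pi q.

Lemma over_diffeo_germ D f p : over_diffeo pi D f -> D p -> over_germ f p.
Proof.
move=> [[oD ofD sf [g [gf sg]]] pf] Dp; split.
  exists g; split; [exact: sf|by apply: sg; exists p| |].
    by apply: filterS (open_nbhs_nbhs (conj oD Dp)) => q /gf.
  apply: (@filterS _ _ _ (f @` D)); last by apply: open_nbhs_nbhs; split=> //; exists p.
  by move=> _ [q Dq <-]; rewrite gf.
by apply: filterS (open_nbhs_nbhs (conj oD Dp)) => q /pf.
Qed.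

Lemma over_germ_diffeo f p : over_germ f p -> exists2 D, over_diffeo pi D f & D p.
Proof.
move=> [[G fG] pf]; have fGn := inverse_pair_near pM pM fG.
have : nbhs p [set q | inverse_pair f G q /\ pi (f q) = pi q] by exact: filterI.
rewrite nbhsE => -[A [oA Ap] AP].
have [sf sG Gf fGK] := fG; have sGn := smooth_at_near pM sG.
have : nbhs (f p) [set z | smooth_at G z /\ f (G z) = z] by exact: filterI.
rewrite nbhsE => -[B [oB Bfp] BP].
have cf q : A q -> {for q, continuous f}.
  by move=> /AP[[sfq _ _ _] _]; exact: smooth_at_cont sfq.
have cG z : B z -> {for z, continuous G}.
  by move=> /BP[sGz _]; exact: smooth_at_cont sGz.
(* Shrinking on both sides makes the image equal to the preimage of [A] under [G] within [B], hence
   open. *)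
exists (A `&` f @^-1` B) => //; split; last by move=> q [/AP[]].
split.
- exact: open_preimageI.
- rewrite (_ : _ @` _ = B `&` G @^-1` A); first exact: open_preimageI.
  apply/seteqP; split=> [_ [q [Aq Bq] <-]|z [Bz AGz]] /=.
    by split=> //=; have [/inverse_pairK -> _] := AP _ Aq.
  by have [_ E] := BP _ Bz; exists (G z) => //; split=> //=; rewrite E.
- by move=> q [/AP[[]]].
- exists G; split=> [q [/AP[/inverse_pairK]]//|z [q [Aq Bq] <-]].
  by have [] := BP _ Bq.
Qed.

Lemma over_germ_cont f p : over_germ f p -> {for p, continuous f}.
Proof. by move=> [[G [sf _ _ _]] _]; exact: smooth_at_cont sf. Qed.

Lemma over_germ_near f p : over_germ f p -> \forall q \near p, over_germ f q.
Proof.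
move=> [[G fG] pf]; have fGn := inverse_pair_near pM pM fG.
by apply: filterS2 fGn (nbhs_interior pf) => q fq pq; split=> //; exists G.
Qed.

Lemma over_germ_near_eq f f' p : (\forall q \near p, f q = f' q) ->
  over_germ f p -> over_germ f' p.
Proof.
move=> ff' [[G fG] pf]; split; first by exists G; exact: inverse_pair_near_eq fG.
by apply: filterS2 ff' pf => q <-.
Qed.

Lemma over_germ_id p : over_germ id p.
Proof.
split; last exact: nearW.
by exists id; split; [exact: smooth_at_id|exact: smooth_at_id|exact: nearW|exact: nearW].
Qed.

Lemma over_germ_comp f g p : over_germ f p -> over_germ g (f p) -> over_germ (g \o f) p.
Proof.
move=> of_ og; have cf := over_germ_cont of_.
have [[F fF] pf] := of_; have [[G gG] pg] := og; split.
  by exists (F \o G); exact: inverse_pair_comp.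
have {}pg : \forall q \near p, pi (g (f q)) = pi (f q) by exact: cf _ pg.
by apply: filterS2 pf pg => q <-.
Qed.

Lemma germ_at_eq (f g : M -> M) p q : germ_at f p = germ_at g q <->
  p = q /\ \forall r \near p, f r = g r.
Proof.
split=> [E|[-> fg]].
  have pq : p = q by case: E.
  split=> //; have /(congr1 snd) /= := E => /seteqP[+ _].
  by rewrite pq; apply; exact: nearW.
rewrite /germ_at (nbhs_singleton fg); congr pair.
apply/seteqP; split=> h hf.
  by apply: filterS2 fg hf => r <-.
by apply: filterS2 fg hf => r ->.
Qed.

Lemma germ_setP f p : over_germ f p -> germ_at f p \in germ_set pi.
Proof. by move=> /over_germ_diffeo[D Df Dp]; apply/mem_set; exists D, f, p. Qed.

Definition to_germ f p (fp : over_germ f p) : germ_arrow pi :=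
  exist (fun a => a \in germ_set pi) _ (germ_setP fp).

Lemma germ_arrowP (a : germ_arrow pi) : exists f p, over_germ f p /\ val a = germ_at f p.
Proof.
case: a => a /= /set_mem[D [f [p [Df Dp ->]]]]; exists f, p; split=> //.
exact: over_diffeo_germ Df Dp.
Qed.

Lemma germ_arrow_over (a : germ_arrow pi) f p : val a = germ_at f p -> over_germ f p.
Proof.
have [g [q [og ->]]] := germ_arrowP a; move=> /germ_at_eq[<- gf].
exact: over_germ_near_eq og.
Qed.

Definition sheet f (U : set M) : set (germ_arrow pi) :=
  [set a | exists2 p, U p & val a = germ_at f p].

(** Two maps with the same germ at a point have the same germs nearby, so each section q |-> [g]_q
    meets the sheet in an open set of base points. *)
Lemma sheet_open f U : open U -> open (sheet f U).
Proof.
move=> oU; suff : germ_open (sheet f U) by [].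
move=> D g Dg; have [[oD _ _ _] _] := Dg.
rewrite openE => p [Dp [a [q Uq aq] ap]].
have [pq gf] : p = q /\ \forall r \near p, g r = f r.
  by apply/germ_at_eq; rewrite -aq ap.
subst q; have Un : \forall r \near p, U r by exact: open_nbhs_nbhs.
have Dn : \forall r \near p, D r by exact: open_nbhs_nbhs.
have gfn := nbhs_interior gf.
rewrite /interior /=; near=> r; have Dr : D r by near: r.
split=> //; exists (to_germ (over_diffeo_germ Dg Dr)) => //.
exists r; first by near: r.
by apply/germ_at_eq; split=> //; near: r.
Unshelve. all: by end_near. Qed.

Lemma sheet_near f (U : set M) (a : germ_arrow pi) p : val a = germ_at f p ->
  nbhs p U -> nbhs a (sheet f U).
Proof.
move=> ap; rewrite nbhsE => -[U' [oU' U'p] U'U].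
apply: (@filterS _ _ _ (sheet f U')).
  by move=> b [q U'q bq]; exists q => //; exact: U'U.
by apply: open_nbhs_nbhs; split; [exact: sheet_open|exists p].
Qed.

(** Continuity of the section q |-> [f]_q at [p], which the final topology provides. *)
Lemma germ_nbhs_sheet f (P : set (germ_arrow pi)) (a : germ_arrow pi) p :
  val a = germ_at f p -> nbhs a P ->
  \forall q \near p, exists2 b, P b & val b = germ_at f q.
Proof.
move=> ap; rewrite nbhsE => -[B [oB Ba] BP].
have /over_germ_diffeo[D Df Dp] := germ_arrow_over ap.
have oS : germ_open B by [].
have : nbhs p [set q | D q /\ exists2 b, B b & val b = germ_at f q].
  by apply: open_nbhs_nbhs; split; [exact: oS|split=> //; exists a].
by apply: filterS => q [_ [b /BP Pb bq]]; exists b.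
Qed.

End Germs.

(** * Injections of orbifold charts *)

Section OrbifoldChart.
Context {R : realType} {X : topologicalType} {n : nat} (c : ochart R X n).
Hypothesis oc : orbifold_chart c.

Lemma ochart_premanifold : premanifold (otop c).
Proof. by case: oc => _ [/manifold_premanifold]. Qed.

Lemma ochart_hausdorff : hausdorff_space (otop c).
Proof. by case: oc => _ [[]]. Qed.

Lemma oact1 x : oact c 1%g x = x.
Proof. by case: oc => _ _ [+ _ _ _]. Qed.

Lemma oactM (a b : ogrp c) x : oact c (a * b)%g x = oact c a (oact c b x).
Proof. by case: oc => _ _ [_ + _ _]. Qed.

Lemma oact_smooth (a : ogrp c) : smooth_map (oact c a).
Proof. by case: oc => _ _ [_ _ + _]. Qed.

Lemma oproj_orbit (x y : otop c) : oproj c x = oproj c y <-> exists a, oact c a x = y.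
Proof. by case: oc => _ _ _ _ []. Qed.

Lemma oproj_act (a : ogrp c) x : oproj c (oact c a x) = oproj c x.
Proof. by apply/esym/oproj_orbit; exists a. Qed.

Lemma oact_inverse_pair (a : ogrp c) x : inverse_pair (oact c a) (oact c a^-1%g) x.
Proof.
split; [exact: oact_smooth|exact: oact_smooth| |]; apply: nearW => y.
  by rewrite -oactM mulVg oact1.
by rewrite -oactM mulgV oact1.
Qed.

End OrbifoldChart.

Section ChartLift.
Context {R : realType} {X : topologicalType} {n k : nat}.
Context (c w : ochart R X n) (oc : orbifold_chart c) (ow : orbifold_chart w).
Context (D : {group ogrp c}) (V : set (otop c)) (gV : group_submanifold D k V).
Context (L : {group ogrp w}) (Z : set (otop w)) (gZ : group_submanifold L k Z).
Context (l : otop w -> otop c) (il : chart_injection l) (lZ : l @` Z `<=` V).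

Let pc := ochart_premanifold oc.
Let pw := ochart_premanifold ow.
Let sV : submanifold k V. Proof. by case: gV. Qed.
Let sZ : submanifold k Z. Proof. by case: gZ. Qed.
Let pV : premanifold (sub_space k V) := sub_premanifold pc sV.
Let pZ : premanifold (sub_space k Z) := sub_premanifold pw sZ.

(** The injection may send [z] to another point of the orbit of [x]. The definition of a group
    submanifold supplies an element of [D] correcting this, and elements of [D] preserve [V]. The
    slice and [V] have the same dimension, so the restriction is a local diffeomorphism once it is
    an immersion. *)
Lemma injection_lift (x : sub_space k V) (z : sub_space k Z) :
  oproj w (set_val z) = oproj c (set_val x) ->
  exists (mu : otop w -> otop c) (nu : otop c -> otop w)
    (muZ : sub_space k Z -> sub_space k V) (nuZ : sub_space k V -> sub_space k Z),
  [/\ inverse_pair mu nu (set_val z), inverse_pair muZ nuZ z,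
      forall v, oproj c (mu v) = oproj w v,
      forall v, set_val (muZ v) = mu (set_val v) & muZ z = x].
Proof.
move=> zx; have [_ [sl il_ _ _] pl] := il.
have Vlz v : Z v -> V (l v) by move=> Zv; apply: lZ; exists v.
have [sVV inv orb] := gV.
have [d Dd dE] : exists2 d, d \in D & oact c d (l (set_val z)) = set_val x.
  have [a aE] : exists a, oact c a (l (set_val z)) = set_val x.
    by apply/(oproj_orbit oc); rewrite pl.
  rewrite -aE; apply: orb; first exact/Vlz/set_valP.
  by rewrite aE; exact: set_valP.
pose mu v := oact c d (l v).
have [li lli] := immersion_inverse_pair pw pc (il_ (set_val z)).
pose nu v := li (oact c d^-1%g v).
have mn : inverse_pair mu nu (set_val z).
  exact: (inverse_pair_comp pw pc pc lli (oact_inverse_pair oc d _)).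
have Vmu v : Z v -> V (mu v) by move=> Zv; apply: inv => //; exact: Vlz.
pose muZ (v : sub_space k Z) : sub_space k V :=
  exist _ (mu (set_val v)) (mem_set (Vmu _ (set_valP v))).
have [r [siz sr rK]] := sub_retraction pw sZ z.
have [smu snu nm _] := mn; have Kmn := inverse_pairK mn.
have smuZ : smooth_at muZ z.
  by apply: (sub_corestrict pc sV pZ); exact: (smooth_at_comp (h := mu) pZ pw pc).
have siV : smooth_at (set_val : sub_space k V -> _) (muZ z).
  by have [r' [+ _ _]] := sub_retraction pc sV (muZ z).
(* [nu] is not known to carry [V] into [Z]; the retraction [r] corrects this and yields a left
   inverse, enough for [muZ] to be an immersion. *)
pose gZV (v : sub_space k V) := r (nu (set_val v)).
have sg : smooth_at gZV (muZ z).
  pose f : sub_space k V -> otop w := nu \o set_val.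
  have s1 : smooth_at f (muZ z) by exact: (smooth_at_comp pV pc pw snu siV).
  have s2 : smooth_at r (f (muZ z)) by rewrite /f /= Kmn.
  exact: (smooth_at_comp pV pw pZ s2 s1).
have gK : \forall v \near z, gZV (muZ v) = v.
  have nmz : \forall v \near z, nu (mu (set_val v)) = set_val v.
    exact: (@set_val_cont _ _ k _ Z z _ nm).
  by apply: filterS2 nmz rK => v vE rv; rewrite /gZV /= vE.
have [nuZ muZP] := immersion_inverse_pair pZ pV (left_inverse_immersion pZ pV smuZ sg gK).
exists mu, nu, muZ, nuZ; split=> //.
  by move=> v; rewrite oproj_act.
by apply: val_inj; rewrite /= /mu dE.
Qed.

End ChartLift.

(** * Extension and uniqueness of germs *)

Section Extension.
Context {R : realType} {X : topologicalType} {n : nat} {I : choiceType}.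
Context {A : I -> ochart R X n} {Y : set X} {k : nat} (C : suborbifold_cover A Y k).
Hypothesis oA : forall i, orbifold_chart (A i).

Local Notation Vs j := (@ssub R X n I A Y k C j).
Local Notation B := (@induced_chart R X n I A Y k C).
Local Notation M := (atlas_objects A).
Local Notation N := (atlas_objects B).
Local Notation W j := (otop (A (set_val j))).
Local Notation V j := (sub_space k (Vs j)).
Local Notation injM i := (existT (fun a => otop (A a) : Type) i).
Local Notation injN j := (existT (fun b => otop (B b) : Type) j).
Local Notation piM := (@atlas_map R X n I A).
Local Notation piN := (@atlas_map R (set_type Y) k (sidx C) B).

Definition incl (p : N) : M := injM (set_val (projT1 p)) (set_val (projT2 p : V (projT1 p))).

Let pW (j : sidx C) : premanifold (W j). Proof. exact: ochart_premanifold. Qed.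
Let sV (j : sidx C) : submanifold k (Vs j). Proof. by case: (ssub_submanifold j). Qed.
Let pV (j : sidx C) : premanifold (V j). Proof. exact: sub_premanifold. Qed.

Lemma atlas_premanifold : premanifold M.
Proof. by apply: coprod_premanifold => i; exact: ochart_premanifold. Qed.

Lemma induced_premanifold : premanifold N.
Proof. exact: (coprod_premanifold pV). Qed.

Let pM := atlas_premanifold.
Let pN := induced_premanifold.

Lemma incl_injective : injective incl.
Proof.
move=> [i x] [j y]; rewrite /incl /= => E.
have ij : i = j by apply: val_inj; exact: existT_inj1 E.
subst j; congr existT; apply: val_inj; exact: existT_inj2 E.
Qed.

Lemma atlas_map_incl p : piM (incl p) = set_val (piN p).
Proof. by case: p. Qed.

Local Notation prM i y := (@coproj R n I (fun a => otop (A a)) i y).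
Local Notation prN j x := (@coproj R k (sidx C) (fun b => otop (B b)) j x).

Let pA i : premanifold (otop (A i)). Proof. exact: ochart_premanifold. Qed.
Let pairM i (y x : otop (A i)) := coprod_inverse_pair pA y x.
Let pairN (j : sidx C) (y x : V j) :=
  @coprod_inverse_pair R k (sidx C) (fun b => otop (B b)) pV j y x.
Let prMK i (y x : otop (A i)) : prM i y (injM i x) = x. Proof. exact: coprojK. Qed.
Let prNK (j : sidx C) (y x : V j) : prN j y (injN j x) = x. Proof. exact: coprojK. Qed.

Lemma incl_retraction p : exists r : M -> N, [/\ smooth_at incl p,
  smooth_at r (incl p) & \forall q \near p, r (incl q) = q].
Proof.
case: p => j x.
have [r [si sr rK]] := sub_retraction (pW j) (sV j) x.
have [s1 s2 _ _] := pairN x x.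
have [_ t2 _ _] := pairM (set_val x) (set_val x).
exists (injN j \o (r \o prM (set_val j) (set_val x))); split.
- pose h1 : N -> W j := set_val \o prN j x.
  have s3 : smooth_at h1 (injN j x).
    by apply: (smooth_at_comp pN (pV j) (pW j) _ s2); rewrite prNK.
  pose h2 : N -> M := (fun y => injM (set_val j) y) \o h1.
  have s4 : smooth_at h2 (injN j x).
    apply: (smooth_at_comp pN (pW j) pM _ s3).
    by have [] := pairM (set_val x) (h1 (injN j x)).
  have E : \forall y \near (x : V j), h2 (injN j y) = incl (injN j y).
    by near=> y; rewrite /h2 /h1 /= prNK.
  exact: (smooth_at_near_eq (E : \forall y \near (injN j x : N), h2 y = incl y) s4).
- pose h1 : M -> V j := r \o prM (set_val j) (set_val x).
  have s3 : smooth_at h1 (incl (injN j x)).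
    by apply: (smooth_at_comp pM (pW j) (pV j) _ t2); rewrite prMK.
  have s4 : smooth_at (fun y : V j => injN j y : N) (h1 (incl (injN j x))).
    by have [] := pairN x (h1 (incl (injN j x))).
  exact: (smooth_at_comp pM (pV j) pN s4 s3).
- have E : \forall y \near (x : V j),
      injN j (r (prM (set_val j) (set_val x) (incl (injN j y)))) = injN j y.
    by apply: filterS rK => y ry; rewrite /incl /= prMK ry.
  exact: E.
Unshelve. all: by end_near. Qed.

Lemma incl_cont : continuous incl.
Proof. by move=> p; have [r [sp _ _]] := incl_retraction p; exact: smooth_at_cont sp. Qed.

Hypothesis vsC : very_strong C.

(** Condition (i) for germs. As [a] ranges over the whole group of the chart, this covers both uses
    of [finite_action_germ]. *)
Lemma fix_germ_trivial (j : sidx C) (x : V j) a :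
  (\forall v \near x, oact (A (set_val j)) a (set_val v) = set_val v) -> a = 1%g.
Proof.
move=> /sub_nbhs[U [oU Ux fU]]; apply: (vsC.1 j a U) => //.
  by exists (set_val x); split=> //; exact: set_valP.
by move=> p [Up Vp]; exact: (fU (exist _ p (mem_set Vp))).
Qed.

(** The quotient of [h'] by [h] is the identity on the member of the cover near [p], but unknown off
    it; [finite_action_germ] in the ambient chart, with the whole group, reduces it to one
    element. *)
Lemma over_germ_unique p (h h' : M -> M) : over_germ piM h (incl p) ->
  over_germ piM h' (incl p) -> (\forall q \near p, h (incl q) = h' (incl q)) ->
  \forall q \near incl p, h q = h' q.
Proof.
case: p => j x oh oh' hh'; set i := set_val j; set y : otop (A i) := set_val x.
set p0 : M := injM i y; rewrite -[incl _]/p0 in oh oh' *.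
have hp0 : h' p0 = h p0 by exact/esym/(nbhs_singleton hh').
have ch' : h' @ p0 --> h' p0 := over_germ_cont pM oh'.
have [[hi hhi] ph] := oh; have K := inverse_pairK hhi; have [sh shi hih hhiK] := hhi.
have [[hi' [sh' _ _ _]] ph'] := oh'.
have chi : hi @ h p0 --> hi (h p0) := smooth_at_cont pM pM shi.
rewrite K in chi; rewrite hp0 in ch'.
have chh : (hi \o h') @ p0 --> p0 by exact: cvg_comp ch' chi.
have [s1 s2 _ s3] := pairM y y.
have F1 : \forall q \near p0, piM (hi (h' q)) = piM q.
  have G1 : \forall z \near h p0, piM (h (hi z)) = piM (hi z) by exact: chi _ ph.
  have G2 : \forall z \near h p0, piM (hi z) = piM z.
    by apply: filterS2 G1 hhiK => z <- ->.
  have G3 : \forall q \near p0, piM (hi (h' q)) = piM (h' q) by exact: ch' _ G2.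
  by apply: filterS2 G3 ph' => q ->.
(* [hi \o h'] is continuous at [p0] and fixes it, so nearby it stays in the same component, where
   [prM] loses nothing. *)
have F2 : \forall q \near p0, injM i (prM i y (hi (h' q))) = hi (h' q).
  exact: chh _ s3.
pose g v := prM i y (hi (h' (injM i v))).
have sg : smooth_at g y.
  have t1 : smooth_at (fun v => h' (injM i v)) y := smooth_at_comp (pA i) pM pM sh' s1.
  have t2 : smooth_at (hi \o (fun v => h' (injM i v))) y.
    by apply: (smooth_at_comp (pA i) pM pM _ t1); rewrite -/p0 hp0.
  apply: (smooth_at_comp (f := hi \o (fun v => h' (injM i v))) (pA i) pM (pA i) _ t2).
  by rewrite /= -/p0 hp0 K.
have gact : \forall v \near y, exists2 a, a \in [set: ogrp (A i)]%G & g v = oact (A i) a v.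
  have F : \forall v \near y, piM (hi (h' (injM i v))) = piM (injM i v) /\
    injM i (prM i y (hi (h' (injM i v)))) = hi (h' (injM i v)) by exact: filterI F1 F2.
  apply: filterS F => v [E1 E2].
  have /(oproj_orbit (oA i))[a aE] : oproj (A i) v = oproj (A i) (g v).
    by rewrite -[RHS]/(piM (injM i (g v))) /g E2 E1.
  by exists a => //; rewrite inE.
(* A neighbourhood of [y] in the chart cuts out a neighbourhood of [x] in the member, so condition
   (i) applies. *)
have faith (a : ogrp (A i)) : a \in [set: ogrp (A i)]%G ->
    (\forall v \near y, oact (A i) a v = v) -> a = 1%g.
  move=> _ ay; apply: (@fix_germ_trivial j x); exact: (@set_val_cont _ _ k _ (Vs j) x _ ay).
have [a _ aE] := finite_action_germ (pA i) (ochart_hausdorff (oA i)) (D := [set: ogrp (A i)]%G)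
  (oact1 (oA i)) (fun a b v _ _ => oactM (oA i) a b v) (fun a _ => oact_smooth (oA i) a)
  faith sg gact.
have a1 : a = 1%g.
  apply: (@fix_germ_trivial j x).
  have G1 : \forall v \near x, g (set_val v) = oact (A i) a (set_val v).
    exact: (@set_val_cont _ _ k _ (Vs j) x _ aE).
  have G2 : \forall v \near x, hi (h (injM i (set_val v))) = injM i (set_val v).
    exact: (@set_val_cont _ _ k _ (Vs j) x _
      (hih : \forall v \near y, hi (h (injM i v)) = injM i v)).
  have G3 : \forall v \near x, h (injM i (set_val v)) = h' (injM i (set_val v)) by exact: hh'.
  near=> v; have <- : g (set_val v) = oact (A i) a (set_val v) by near: v.
  rewrite /g; have <- : h (injM i (set_val v)) = h' (injM i (set_val v)) by near: v.
  have -> : hi (h (injM i (set_val v))) = injM i (set_val v) by near: v.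
  exact: prMK.
have F3 : \forall q \near p0, hi (h' q) = q.
  have G : \forall v \near y, hi (h' (injM i v)) = injM i v.
    have F2' : \forall v \near y, injM i (g v) = hi (h' (injM i v)) by exact: F2.
    by apply: filterS2 aE F2' => v; rewrite a1 (oact1 (oA i)) => ->.
  exact: G.
have F4 : \forall q \near p0, h (hi (h' q)) = h' q by exact: ch' _ hhiK.
by apply: filterS2 F3 F4 => q ->.
Unshelve. all: by end_near. Qed.

Lemma set_val_inj (T : Type) (U : set T) (x y : set_type U) : set_val x = set_val y -> x = y.
Proof. exact: val_inj. Qed.

Section InducedAction.
Context (j : sidx C).

(* Meaningful only for [a] in [sgrp j]. *)
Definition sub_act (a : ogrp (A (set_val j))) (v : V j) : V j :=
  insubd v (oact (A (set_val j)) a (set_val v)).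

Lemma sub_actE a v : a \in sgrp j -> set_val (sub_act a v) = oact (A (set_val j)) a (set_val v).
Proof.
move=> ja; have [_ inv _] := ssub_submanifold j.
by apply: insubdK; apply/mem_set/inv => //; exact: set_valP.
Qed.

Lemma sub_act_smooth a : a \in sgrp j -> smooth_map (sub_act a).
Proof.
move=> ja v; apply: (sub_corestrict (pW j) (sV j) (pV j)).
have [r [sv _ _]] := sub_retraction (pW j) (sV j) v.
have sa := oact_smooth (oA (set_val j)) a (set_val v).
apply: smooth_at_near_eq (smooth_at_comp (pV j) (pW j) (pW j) sa sv).
by near=> w; rewrite /= sub_actE.
Unshelve. all: by end_near. Qed.

Lemma over_germ_sub_act (x : V j) (u : V j -> V j) : smooth_at u x ->
  (\forall v \near x, oproj (A (set_val j)) (set_val (u v)) = oproj (A (set_val j)) (set_val v)) ->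
  exists2 a, a \in sgrp j & \forall v \near x, u v = sub_act a v.
Proof.
move=> su pu; apply: finite_action_germ => //.
- exact: sub_hausdorff (ochart_hausdorff (oA _)).
- by move=> v; apply: set_val_inj; rewrite sub_actE// oact1.
- move=> a b v ja jb; apply: set_val_inj.
  by rewrite !sub_actE ?groupM// oactM.
- exact: sub_act_smooth.
- move=> a ja fa; apply: (@fix_germ_trivial j x).
  by apply: filterS fa => v E; rewrite -sub_actE// E.
(* The projection only yields an element of the whole group; the definition of a group submanifold
   replaces it by one of [sgrp j], which acts on the member. *)
- apply: filterS pu => v /esym/(oproj_orbit (oA _))[a aE].
  have [_ _ orb] := ssub_submanifold j.
  have [||b jb bE] := orb a (set_val v); first exact: set_valP.
    by rewrite aE; exact: set_valP.
  by exists b => //; apply: set_val_inj; rewrite sub_actE// bE aE.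
Qed.

End InducedAction.

Lemma over_germ_extension p (f : N -> N) : over_germ piN f p ->
  exists h : M -> M, over_germ piM h (incl p) /\ \forall q \near p, h (incl q) = incl (f q).
Proof.
case: p => j1 x1 [[fi ffi] pf]; have [sf sfi fif ffiK] := ffi.
case E : (f (injN j1 x1)) => [j2 x2].
set i1 := set_val j1; set i2 := set_val j2.
set y1 : otop (A i1) := set_val x1; set y2 : otop (A i2) := set_val x2.
have y12 : oproj (A i1) y1 = oproj (A i2) y2.
  have := nbhs_singleton pf; rewrite E => /(congr1 set_val) /= E'; exact/esym/E'.
have [||w [L [Z [ow gZ [[z Zz zE] _] [l1 [il1 l1Z]] [l2 [il2 l2Z]]]]]] :=
  vsC.2 j1 j2 (oproj (A i1) y1).
- by exists y1 => //; exact: set_valP.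
- by exists y2 => //; exact: set_valP.
pose zZ : sub_space k Z := exist _ z (mem_set Zz).
have [mu1 [nu1 [mZ1 [nZ1 [mn1 mnZ1 pm1 mZE1 mZz1]]]]] :=
  injection_lift (oA i1) ow (ssub_submanifold j1) gZ il1 l1Z (x := x1) (z := zZ) zE.
have [mu2 [nu2 [mZ2 [nZ2 [mn2 mnZ2 pm2 mZE2 mZz2]]]]] :=
  injection_lift (oA i2) ow (ssub_submanifold j2) gZ il2 l2Z (x := x2) (z := zZ) (etrans zE y12).
have pw : premanifold (otop w) by exact: ochart_premanifold.
have sZ : submanifold k Z by case: gZ.
have pZ : premanifold (sub_space k Z) by exact: sub_premanifold.
have mu1z : mu1 z = y1 by have := mZE1 zZ; rewrite mZz1.
have mu2z : mu2 z = y2 by have := mZE2 zZ; rewrite mZz2.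
have [smZ1 snZ1 nmZ1 mnZ1'] := mnZ1; have [smZ2 snZ2 nmZ2 mnZ2'] := mnZ2.
have KZ1 := inverse_pairK mnZ1; have KZ2 := inverse_pairK mnZ2.
rewrite mZz1 in snZ1 mnZ1' KZ1; rewrite mZz2 in snZ2 mnZ2' KZ2.
have cnZ1 : nZ1 @ x1 --> zZ by rewrite -[X in _ --> X]KZ1; exact: (smooth_at_cont (pV j1) pZ snZ1).
have cnZ2 : nZ2 @ x2 --> zZ by rewrite -[X in _ --> X]KZ2; exact: (smooth_at_cont (pV j2) pZ snZ2).
(* The transition between the two members through the slice [Z], and its local inverse. *)
pose hV v := mZ2 (nZ1 v); pose hVi v := mZ1 (nZ2 v).
have hVx1 : hV x1 = x2 by rewrite /hV KZ1.
have shV : smooth_at hV x1.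
  by apply: (smooth_at_comp (pV j1) pZ (pV j2) _ snZ1); rewrite KZ1.
have chV : hV @ x1 --> x2.
  by rewrite -[X in _ --> X]hVx1; exact: (smooth_at_cont (pV j1) (pV j2) shV).
have hVK : \forall v \near x1, hVi (hV v) = v.
  have G : \forall v \near x1, nZ2 (mZ2 (nZ1 v)) = nZ1 v by exact: cnZ1 _ nmZ2.
  by apply: filterS2 G mnZ1' => v E1 E2; rewrite /hVi /hV E1.
have hVix2 : hVi x2 = x1 by rewrite /hVi KZ2.
have shVi : smooth_at hVi x2.
  by apply: (smooth_at_comp (pV j2) pZ (pV j1) _ snZ2); rewrite KZ2.
have chVi : hVi @ x2 --> x1.
  by rewrite -[X in _ --> X]hVix2; exact: (smooth_at_cont (pV j2) (pV j1) shVi).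
have phVi : \forall v \near x2, oproj (A i1) (set_val (hVi v)) = oproj (A i2) (set_val v).
  by apply: filterS mnZ2' => v vE; rewrite /hVi mZE1 pm1 -pm2 -mZE2 vE.
have cf : f @ (injN j1 x1 : N) --> f (injN j1 x1) := smooth_at_cont pN pN sf.
have [s1 s1' s2 s3] := pairN x2 x2.
(* Precomposing [f] with [hVi] gives a self-map of one member that preserves the projection near
   [x2], as [over_germ_sub_act] requires. *)
pose u v := prN j2 x2 (f (injN j1 (hVi v))).
have su : smooth_at u x2.
  have t1 : smooth_at (fun v => injN j1 (hVi v) : N) x2.
    apply: (smooth_at_comp (pV j2) (pV j1) pN _ shVi).
    by have [] := pairN x1 (hVi x2).
  have t2 : smooth_at (fun v => f (injN j1 (hVi v))) x2.
    by apply: (smooth_at_comp (pV j2) pN pN _ t1); rewrite hVix2.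
  by apply: (smooth_at_comp (pV j2) pN (pV j2) _ t2); rewrite hVix2 E.
have prf : \forall v \near x1, injN j2 (prN j2 x2 (f (injN j1 v))) = f (injN j1 v).
  by rewrite E in cf; exact: cf _ s3.
have pu : \forall v \near x2, oproj (A i2) (set_val (u v)) = oproj (A i2) (set_val v).
  have G1 : \forall v \near x1,
      oproj (A i2) (set_val (prN j2 x2 (f (injN j1 v)))) = oproj (A i1) (set_val v).
    have pf' : \forall v \near x1, piN (f (injN j1 v)) = piN (injN j1 v) by exact: pf.
    apply: filterS2 prf pf' => v E1 /(congr1 set_val) E2.
    transitivity (set_val (piN (injN j2 (prN j2 x2 (f (injN j1 v)))))) => //.
    by rewrite E1 E2.
  have G2 : \forall v \near x2, oproj (A i2) (set_val (u v)) = oproj (A i1) (set_val (hVi v)).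
    exact: chVi _ G1.
  by apply: filterS2 G2 phVi => v -> ->.
have [d jd dE] := over_germ_sub_act su pu.
(* On the member, [f] is [d] after [hV], that is, [d] after [mu2] after [nu1]; this last composite
   is defined on the ambient chart as well. *)
pose h := (fun y => injM i2 y) \o (oact (A i2) d \o (mu2 \o (nu1 \o prM i1 y1))).
have nu1y : nu1 y1 = z by rewrite -mu1z (inverse_pairK mn1).
have ymn1 : inverse_pair nu1 mu1 y1 by rewrite -mu1z; exact: inverse_pair_sym mn1.
have pr1 : inverse_pair (prM i1 y1) (fun y => injM i1 y) (injM i1 y1).
  exact: inverse_pair_sym (pairM y1 y1).
exists h; split; [split|].
- have q1 : inverse_pair (nu1 \o prM i1 y1) ((fun y => injM i1 y) \o mu1) (injM i1 y1).
    by apply: (inverse_pair_comp pM (pA i1) pw pr1); rewrite prMK.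
  have q2 := inverse_pair_comp (h := mu2) (hi := nu2) pM pw (pA i2) q1.
  have {q2} q2 := q2 (eq_rect_r (fun t => inverse_pair mu2 nu2 t) mn2
    (etrans (congr1 nu1 (prMK y1 y1)) nu1y)).
  have q3 := inverse_pair_comp pM (pA i2) (pA i2) q2 (oact_inverse_pair (oA i2) d _).
  by eexists; exact: (inverse_pair_comp pM (pA i2) pM q3 (pairM y2 _)).
- have G : \forall v \near y1, piM (h (injM i1 v)) = piM (injM i1 v).
    have [_ _ G _] := ymn1; apply: filterS G => v vE.
    rewrite /h /= /atlas_map /= prMK oproj_act// pm2.
    by rewrite -[in RHS]vE pm1.
  exact: G.
- have G : \forall v \near x1, h (incl (injN j1 v)) = incl (f (injN j1 v)).
    have nm1 : \forall v \near zZ, nu1 (mu1 (set_val v)) = set_val v.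
      by have [_ _ nm _] := mn1; exact: (@set_val_cont _ _ k _ Z zZ _ nm).
    have nm1' : \forall v \near x1, nu1 (mu1 (set_val (nZ1 v))) = set_val (nZ1 v).
      exact: cnZ1 _ nm1.
    have dE' : \forall v \near x1, u (hV v) = sub_act d (hV v) by exact: chV _ dE.
    near=> v; rewrite /h /incl /= prMK.
    (* [nZ1] comes from the inverse function theorem on the slice, independently of [nu1]; near [x1]
       they agree on the member because both invert [mu1] there. *)
    have vE : mZ1 (nZ1 v) = v by near: v.
    have -> : nu1 (set_val v) = set_val (nZ1 v).
      by rewrite -[in LHS]vE mZE1; near: v.
    rewrite -mZE2 -[mZ2 _]/(hV v) -sub_actE//.
    have <- : u (hV v) = sub_act d (hV v) by near: v.
    have hvE : hVi (hV v) = v by near: v.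
    have <- : injN j2 (prN j2 x2 (f (injN j1 v))) = f (injN j1 v) by near: v.
    by rewrite /u hvE.
  exact: G.
Unshelve. all: by end_near. Qed.

End Extension.

(** * The embedding of germ groupoids *)

Section Embedding.
Context {R : realType} {X : topologicalType} {n : nat} {I : choiceType}.
Context {A : I -> ochart R X n} {Y : set X} {k : nat} (C : suborbifold_cover A Y k).
Hypothesis oA : forall i, orbifold_chart (A i).

Local Notation B := (@induced_chart R X n I A Y k C).
Local Notation M := (atlas_objects A).
Local Notation N := (atlas_objects B).
Local Notation piM := (@atlas_map R X n I A).
Local Notation piN := (@atlas_map R (set_type Y) k (sidx C) B).
Local Notation incl := (@incl R X n I A Y k C).

Let pM := atlas_premanifold oA.
Let pN := induced_premanifold C oA.
Let ci := incl_cont (C := C) oA.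

Lemma incl_separated (U : set N) p : open U -> U p ->
  exists O, [/\ open O, O (incl p) & incl @^-1` O `<=` U].
Proof.
case: p => j x oU Ux; have /sigT_openP/(_ j)[Q oO OE] := oU.
exists (existT (fun i => otop (A i) : Type) (set_val j) @` Q); split.
- exact: existT_open_map.
- exists (set_val x) => //.
  by have : (set_val @^-1` Q : set (set_type _)) x by rewrite OE.
- move=> [j' x'] [y Oy E].
  have jj : j = j' by apply: set_val_inj; exact: existT_inj1 E.
  subst j'; have yE := existT_inj2 E.
  have : (set_val @^-1` Q : set (set_type _)) x' by rewrite /preimage /= -yE.
  by rewrite OE.
Qed.

Lemma incl_smooth_embedding : smooth_embedding incl.
Proof.
split.
- by move=> p; have [r [sp _ _]] := incl_retraction oA p.
- move=> p; have [r [sp sr rK]] := incl_retraction oA p.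
  exact: left_inverse_immersion sr rK.
- exact: incl_injective.
- by apply: topological_embedding => //; exact: incl_separated.
Qed.

Hypothesis vsC : very_strong C.

Lemma germ_extension (a : germ_arrow piN) : exists b : germ_arrow piM,
  exists f h p, [/\ val a = germ_at f p, val b = germ_at h (incl p)
                  & \forall q \near p, h (incl q) = incl (f q)].
Proof.
have [f [p [fp ap]]] := germ_arrowP a.
have [h [hp hE]] := over_germ_extension oA vsC fp.
by exists (to_germ pM hp), f, h, p.
Qed.

Definition incl_germ a := projT1 (cid (germ_extension a)).

(** By uniqueness any extension computes the chosen germ, so identities between image arrows are
    proved by exhibiting extensions. *)
Lemma incl_germE a f h p : val a = germ_at f p -> over_germ piM h (incl p) ->
  (\forall q \near p, h (incl q) = incl (f q)) -> val (incl_germ a) = germ_at h (incl p).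
Proof.
rewrite /incl_germ; case: cid => b [f' [h' [p' [ap bp h'E]]]] /= ap' oh hE.
have /germ_at_eq[pp ff'] := etrans (esym ap) ap'; subst p'.
apply: (etrans bp); apply/germ_at_eq; split=> //.
apply: (over_germ_unique oA vsC _ oh); first exact: germ_arrow_over bp.
near=> q; have -> : h' (incl q) = incl (f' q) by near: q.
have -> : f' q = f q by near: q.
by apply/esym; near: q.
Unshelve. all: by end_near. Qed.

Lemma incl_germP a f p : val a = germ_at f p -> exists h,
  [/\ over_germ piM h (incl p), \forall q \near p, h (incl q) = incl (f q),
      val (incl_germ a) = germ_at h (incl p) &
      \forall q \near p, forall b, val b = germ_at f q -> val (incl_germ b) = germ_at h (incl q)].
Proof.
move=> ap; have [h [hp hE]] := over_germ_extension oA vsC (germ_arrow_over pN ap).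
exists h; split=> //; first exact: incl_germE ap hp hE.
have hpn : \forall q \near p, over_germ piM h (incl q).
  exact: ci (over_germ_near pM hp).
apply: filterS2 hpn (nbhs_interior hE) => q hq hEq b bq.
exact: incl_germE bq hq hEq.
Qed.

Lemma incl_germ_inj : injective incl_germ.
Proof.
move=> a b ab; have [f [p [_ ap]]] := germ_arrowP a.
have [g [q [_ bq]]] := germ_arrowP b.
have [h [_ hE aE _]] := incl_germP ap; have [h' [_ h'E bE _]] := incl_germP bq.
have /germ_at_eq[/incl_injective pq hh'] :=
  etrans (etrans (esym bE) (congr1 _ (esym ab))) aE.
subst q.
apply: val_inj; apply: (etrans ap); apply: (etrans _ (esym bq)); apply/germ_at_eq; split=> //.
have {}hh' : \forall r \near p, h' (incl r) = h (incl r) by exact: ci hh'.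
near=> r; apply: (@incl_injective _ _ _ _ _ _ _ C).
have <- : h (incl r) = incl (f r) by near: r.
have <- : h' (incl r) = incl (g r) by near: r.
by apply/esym; near: r.
Unshelve. all: by end_near. Qed.

Local Notation GN := (garr (atlas_groupoid B)).
Local Notation GM := (garr (atlas_groupoid A)).

(** In charts of sheets an arrow is given by its source, so [incl_germ] has the same coordinate
    expression [g] as [incl]. *)
Lemma incl_germ_rep (a : GN) : exists c d g, [/\ charts GN c, charts GM d,
  local_rep (incl_germ : GN -> GM) c d a g & injective ('d g (c a))].
Proof.
have [f [p [fp ap]]] := germ_arrowP a.
have [D Df Dp] := over_germ_diffeo pN fp.
have [h [hp hE aE aEn]] := incl_germP ap.
have [D' D'h D'p] := over_germ_diffeo pM hp.
have [_ /(_ p)[c [d [g [Nc Md lr ig]]]] _ _] := incl_smooth_embedding.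
have hc := maximal_homeo (charts_maximal pN Nc).
have [cp sg gE] := lr.
have srcE (X' : Type) m (L : smooth_space R m) (pi : L -> X') (b : germ_arrow pi) u q :
    val b = germ_at u q -> germ_src b = q by rewrite /germ_src => ->.
pose e : chart R GN k := Chart [set b : GN | exists q, [/\ D q, cdom c q & val b = germ_at f q]]
  (fun b : GN => c (germ_src b)).
pose e' : chart R GM n := Chart [set b : GM | exists q, [/\ D' q, cdom d q & val b = germ_at h q]]
  (fun b : GM => d (germ_src b)).
have ea : e a = c p by rewrite /= (srcE _ _ _ _ a f p).
have Ge : charts GN e by exists D, f, c; split; [exact: Df|exact: Nc| |].
have Ge' : charts GM e' by exists D', h, d; split; [exact: D'h|exact: Md| |].
have cea : cdom e a by exists p; split; [exact: Dp|exact: cp|exact: ap].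
exists e, e', g; split; [exact: Ge|exact: Ge'| |rewrite ea; exact: ig].
split; [exact: cea|rewrite ea; exact: sg|].
have D'n : \forall q \near p, D' (incl q).
  by apply: ci; apply: open_nbhs_nbhs; split=> //; case: D'h => -[].
have Un : nbhs p [set q | (cdom d (incl q) /\ d (incl q) = g (c q)) /\
    ((forall b, val b = germ_at f q -> val (incl_germ b) = germ_at h (incl q)) /\ D' (incl q))].
  by apply: filterI; [exact: gE|apply: filterI; [exact: aEn|exact: D'n]].
have aU : nbhs (a : GN) (sheet f _) := sheet_near pN ap Un.
apply: (filterS _ aU) => b [q [[dq gq] [bE D'q]] bq].
have bE' := bE _ bq.
split; first by exists (incl q); split; [exact: D'q|exact: dq|exact: bE'].
by rewrite /= (srcE _ _ _ _ _ _ _ bE') (srcE _ _ _ _ _ _ _ bq).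
Qed.

Lemma incl_germ_smooth_embedding : smooth_embedding (incl_germ : GN -> GM).
Proof.
split.
- by move=> a; have [c [d [g []]]] := incl_germ_rep a; exists c, d, g.
- exact: incl_germ_rep.
- exact: incl_germ_inj.
- apply: topological_embedding => [a P aP|U a oU Ua].
    have [f [p [_ ap]]] := germ_arrowP a; have [h [_ _ aE aEn]] := incl_germP ap.
    have Pn : \forall q \near p, exists2 b, P b & val b = germ_at h (incl q).
      exact: ci (germ_nbhs_sheet pM aE aP).
    have Un : nbhs p [set q | (exists2 b, P b & val b = germ_at h (incl q)) /\
        forall b, val b = germ_at f q -> val (incl_germ b) = germ_at h (incl q)].
      by apply: filterI; [exact: Pn|exact: aEn].
    have aU : nbhs (a : GN) (sheet f _) := sheet_near pN ap Un.
    apply: (filterS _ aU) => b [q [[b' Pb' b'q] bE] bq].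
    rewrite /preimage /= (_ : incl_germ b = b')//; apply: val_inj.
    exact: etrans (bE _ bq) (esym b'q).
  have [f [p [_ ap]]] := germ_arrowP a; have [h [_ _ aE aEn]] := incl_germP ap.
  have Un : \forall q \near p, exists2 b, U b & val b = germ_at f q.
    by apply: (germ_nbhs_sheet pN ap); exact: open_nbhs_nbhs.
  have : nbhs p [set q | (exists2 b, U b & val b = germ_at f q) /\
     forall b, val b = germ_at f q -> val (incl_germ b) = germ_at h (incl q)].
    exact: filterI.
  rewrite nbhsE => -[W [oW Wp] WP]; have [Q [oO Op OW]] := incl_separated oW Wp.
  exists (sheet h Q); split; [exact: sheet_open|by exists (incl p)|].
  (* An arrow [b] sent into this sheet has its source in [W], where [U] contains an arrow with the
     same image; injectivity identifies the two. *)
  move=> b [q Oq bq]; have [g [r [_ br]]] := germ_arrowP b.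
  have [h' [_ _ bE _]] := incl_germP br.
  have /germ_at_eq[rq hh'] := etrans (esym bE) bq; subst q.
  have [[b0 Ub0 b0r] b0E] := WP _ (OW _ Oq).
  rewrite (_ : b = b0)//; apply: incl_germ_inj; apply: val_inj.
  exact: etrans bq (esym (b0E _ b0r)).
Qed.

Lemma incl_groupoid_morphism :
  @groupoid_morphism R k k n n (atlas_groupoid B) (atlas_groupoid A) incl incl_germ.
Proof.
split.
- by split; [case: incl_smooth_embedding|case: incl_germ_smooth_embedding].
- move=> a; have [f [p [_ ap]]] := germ_arrowP a; have [h [_ hE aE _]] := incl_germP ap.
  rewrite /= /germ_src /germ_tgt aE ap /=; split=> //; exact: nbhs_singleton hE.
- move=> b a c [f [g [p [ap bp cp]]]].
  have [ha [oha haE aE _]] := incl_germP ap; have [hb [ohb hbE bE _]] := incl_germP bp.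
  have hap := nbhs_singleton haE.
  exists hb, ha, (incl p); split=> //; first by rewrite hap.
  apply: incl_germE cp _ _; first by apply: over_germ_comp => //; rewrite hap.
  have hbE' : \forall q \near p, hb (incl (g q)) = incl (f (g q)).
    exact: (over_germ_cont pN (germ_arrow_over pN ap)) hbE.
  by apply: filterS2 haE hbE' => q /= -> ->.
- move=> p u up; apply: incl_germE up _ _; first exact: over_germ_id.
  by near=> q.
- move=> a b [f [g [p [ap bp gf fg]]]].
  have [ha [oha haE aE _]] := incl_germP ap; have [hb [ohb hbE bE _]] := incl_germP bp.
  have hap := nbhs_singleton haE; have hbp := nbhs_singleton hbE.
  have /germ_at_eq[_ gfE] := gf; have /germ_at_eq[_ fgE] := fg.
  have gfp : g (f p) = p by exact: (nbhs_singleton gfE).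
  have cf := over_germ_cont pN (germ_arrow_over pN ap).
  have cg : g @ f p --> g (f p) := over_germ_cont pN (germ_arrow_over pN bp).
  exists ha, hb, (incl p); split=> //; first by rewrite hap.
    (* [ha] and [hb] were chosen separately; their composite and the identity both extend the
       identity germ, so they agree by uniqueness. *)
    apply/germ_at_eq; split=> //; apply: (over_germ_unique oA vsC).
    - by apply: over_germ_comp => //; rewrite hap.
    - exact: over_germ_id.
    - have hbE' : \forall q \near p, hb (incl (f q)) = incl (g (f q)) by exact: cf hbE.
      near=> q; rewrite /=; have -> : ha (incl q) = incl (f q) by near: q.
      have -> : hb (incl (f q)) = incl (g (f q)) by near: q.
      by congr incl; near: q.
  rewrite hap; apply/germ_at_eq; split=> //; apply: (over_germ_unique oA vsC).
  - by apply: over_germ_comp => //; rewrite hbp gfp.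
  - exact: over_germ_id.
  - rewrite gfp in cg.
    have haE' : \forall q \near f p, ha (incl (g q)) = incl (f (g q)) by exact: cg _ haE.
    near=> q; rewrite /=; have -> : hb (incl q) = incl (g q) by near: q.
    have -> : ha (incl (g q)) = incl (f (g q)) by near: q.
    by congr incl; near: q.
Unshelve. all: by end_near. Qed.

Lemma very_strong_is_strong : strong C.
Proof.
exists incl, incl_germ; split.
  split; [exact: incl_groupoid_morphism|exact: incl_smooth_embedding|].
  exact: incl_germ_smooth_embedding.
(* Arrows preserve the projection, so passing from [incl p] to its orbit does not change the image
   in [X]. *)
have orbM (p q : gobj (atlas_groupoid A)) : gorbit p q -> piM q = piM p.
  move=> [a [<- <-]]; have [f [r [[_ /nbhs_singleton fr] ar]]] := germ_arrowP a.
  by rewrite /= /germ_src /germ_tgt ar.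
move=> O _; apply/seteqP; split=> [_ [r [p Op /orbM ->] <-]|_ [_ [p Op <-] <-]].
  by exists (piN p); [exists p|rewrite atlas_map_incl].
exists (incl p); last by rewrite atlas_map_incl.
exists p => //; exists (to_germ pM (over_germ_id piM pM (incl p))).
by rewrite /= /germ_src /germ_tgt.
Qed.

End Embedding.

Theorem theorem2 (R : realType) (X : topologicalType) (n : nat) :
  (hausdorff_space X -> @second_countable X ->
    forall (I : countType) (A : I -> ochart R X n),
      orbifold_atlas (members A) ->
      forall (Y : set X) (k : nat) (C : suborbifold_cover A Y k),
        very_strong C -> strong C) /\
  (forall S : ochart R X n -> Prop, orbifold S ->
    forall Y : set X, very_strong_suborbifold S Y -> strong_suborbifold S Y).
Proof.
have vs (I : countType) (A : I -> ochart R X n) : orbifold_atlas (members A) ->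
    forall (Y : set X) (k : nat) (C : suborbifold_cover A Y k), very_strong C -> strong C.
  move=> [oA _ _] Y k C; apply: very_strong_is_strong => i.
  by apply: oA; exists i.
split=> [_ _ I A /vs//|S _ Y [I [A [k [C [[oA AS] vsC]]]]]].
by exists I, A, k, C; split=> //; exact: vs.
Qed.
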